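(* Let $n$ take values only in an infinite set of odd square-free integers greater than $1$ such that \[ \frac{(\log n)^7}{p_n}\to 0 \quad\text{as } n\to\infty, \] where $p_n$ is the smallest prime factor of $n$, and let $r$ be real. Let $J(z)=\sum_{j=1}^{n-1}\left(\frac{j}{n}\right)z^j$ be the character polynomial of degree $n-1$. Then \[ \limsup_{n\to\infty}\,\max_{V\in\mathcal{V}_n}\,F(J_r+V_r)\le f(r). \]
   Context: For real $\alpha\ge1$ and $A\in\mathbb{C}[z]$, $\|A\|_\alpha=\left(\frac{1}{2\pi}\int_0^{2\pi}|A(e^{i\theta})|^\alpha d\theta\right)^{1/\alpha}$. The merit factor of $A$ is $F(A)=\frac{\|A\|_2^4}{\|A\|_4^4-\|A\|_2^4}$. For a polynomial $A$ of degree at most $n-1$ and real $r$, the rotation is $A_r(z)=z^{-\lfloor nr\rfloor}A(z)\bmod (z^n-1)$. $\left(\frac{\cdot}{n}\right)$ denotes the Jacobi symbol. $\mathcal{V}_n$ is the set of polynomials $\sum_{j=0}^{n-1}v_jz^j$ with $v_j\in\{0,-1,+1\}$ and $v_j=0$ if and only if $\gcd(j,n)=1$ (so $J+V$ has all coefficients in $\{-1,+1\}$). The function $f$ is $1$-periodic with $f(r)=\dfrac{1}{\frac16+8\left(|r|-\frac14\right)^2}$ for $-\frac12<r\le\frac12$. *)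

(* Defs.v *)
From Stdlib Require Import Reals ZArith.
From Coquelicot Require Import Coquelicot.
From mathcomp Require Import ssreflect ssrbool eqtype ssrnat seq div fintype prime.

Set Implicit Arguments.
Unset Strict Implicit.

Definition legendre (a p : nat) : Z :=
  if (p %| a)%N then 0%Z
  else if [exists x : 'I_p, (x * x) %% p == a %% p] then 1%Z else (-1)%Z.

Definition jacobi (a n : nat) : Z :=
  foldr (fun pe acc => (Z.pow (legendre a (fst pe)) (Z.of_nat (snd pe)) * acc)%Z)
        1%Z (prime_decomp n).

Definition squarefree (n : nat) : Prop :=
  forall p : nat, prime p -> ~~ (p * p %| n)%N.

Local Open Scope R_scope.

Fixpoint rsum (n : nat) (g : nat -> R) : R :=
  match n with O => 0 | S m => rsum m g + g m end.

(* The polynomial A(z) = sum_{j<n} a j z^j (real coefficients).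
   Real and imaginary parts of A(e^{i theta}) and |A(e^{i theta})|. *)
Definition poly_re (n : nat) (a : nat -> R) (t : R) : R :=
  rsum n (fun j => a j * cos (INR j * t)).
Definition poly_im (n : nat) (a : nat -> R) (t : R) : R :=
  rsum n (fun j => a j * sin (INR j * t)).
Definition poly_abs (n : nat) (a : nat -> R) (t : R) : R :=
  sqrt (poly_re n a t ^ 2 + poly_im n a t ^ 2).

(* x^y for x >= 0, y > 0, with 0^y = 0. *)
Definition rpow (x y : R) : R := if Rlt_dec 0 x then Rpower x y else 0.

Definition Lnorm (alpha : R) (n : nat) (a : nat -> R) : R :=
  rpow (/ (2 * PI) * RInt (fun t => rpow (poly_abs n a t) alpha) 0 (2 * PI))
       (/ alpha).

Definition merit (n : nat) (a : nat -> R) : R :=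
  Lnorm 2 n a ^ 4 / (Lnorm 4 n a ^ 4 - Lnorm 2 n a ^ 4).

Definition floorZ (x : R) : Z := Int_part x.

(* Rotation A_r(z) = z^{-floor(n r)} A(z) mod (z^n - 1):
   its j-th coefficient (j < n) is a_{(j + floor(n r)) mod n}. *)
Definition rotp (n : nat) (r : R) (a : nat -> R) : nat -> R :=
  fun j => a (Z.to_nat (Z.modulo (Z.of_nat j + floorZ (INR n * r)) (Z.of_nat n))).

Definition Jpoly (n : nat) : nat -> R :=
  fun j => if ((0 < j) && (j < n))%N then IZR (jacobi j n) else 0.

Definition inVn (n : nat) (v : nat -> Z) : Prop :=
  forall j : nat, (j < n)%N ->
    (v j = 0%Z \/ v j = 1%Z \/ v j = (-1)%Z) /\ (v j = 0%Z <-> coprime j n).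

Definition addp (a b : nat -> R) : nat -> R := fun j => a j + b j.

(* f : 1-periodic, f(r) = 1/(1/6 + 8(|r|-1/4)^2) on (-1/2, 1/2].
   r + floor(1/2 - r) is the representative of r mod 1 in (-1/2, 1/2]. *)
Definition fper (r : R) : R :=
  let s := r + IZR (floorZ (/2 - r)) in
  / (/6 + 8 * (Rabs s - /4) ^ 2).

(* Main.v *)
Require Import Defs.
From Stdlib Require Import Reals ZArith Lra Lia.
From Coquelicot Require Import Coquelicot.
From mathcomp Require Import ssreflect ssrfun ssrbool eqtype ssrnat seq div fintype prime.
From mathcomp Require Import zify.

(** Write A = J_r + V_r. Since A^2 has degree below 2n, the fourth power norm of A is the
    mean of |A|^4 over the 2n-th roots of unity, and |A|^4 >= |P|^4 - 4 |P|^3 |A - P| for any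
    comparison function P. At the n-th roots of unity take P = J_r, of modulus sqrt n or 0
    by the evaluation of the Gauss sum. At the other 2n-th roots, A is the Fourier transform
    of a_j w^j with w = exp(i pi / n); take for P the transform of the coefficients of J_r
    times the partial Fourier sum of w^j with 2T + 1 terms, T fixed. Then P is a combination
    of 2T + 1 translates of the character, so its fourth moment only involves complete sums
    of chi(x+a) chi(x+b) chi(x+c) chi(x+d) with bounded shifts. These are reduced to the
    least prime p of n, where an elementary fourth-moment argument over all cubics bounds
    them by O(p^(3/4)). The main terms are evaluated exactly by Parseval's identity, and V
    is small in quadratic mean because only O(n log n / p) residues are not coprime to n. *)

Set Implicit Arguments.
Unset Strict Implicit.
Unset Printing Implicit Defensive.

(** The claim is one-sided, so the fourth moment only has to be bounded below. The inequality in use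
    is the tangent line of $t^4$ at $|P|$: it needs a bound on $P$ alone, whereas for arbitrary $V$
    no pointwise bound on $A$ is at hand. At the odd points $P$ is at most $\sqrt n$ times the
    $\ell^1$ norm $M$ of the kept Fourier coefficients $c_m$ of $w^j$. These decay like $1/m$, so $M
    = O(\log T)$ while the discarded $\ell^2$ mass is $O(1/T)$; the loss, of order $M^3 T^{-1/2}$
    relative to $n^3$, is small for a suitable fixed $T$. Because $T$ does not grow with $n$, any
    power of $p$ saved in the character sums is enough, and the elementary exponent $3/4$ can stand
    in for Weil's bound.

    Divided by $n^3$, the even points contribute $1$ and the odd points $2 + y^2 - 2/3$, where $y$
    is the modulus of the sum of the squares of the $c_m$ twisted by the rotation and $2/3$ is twice
    the sum of $|c_m|^4$. In the limit $y^2 = 16(|r| - 1/4)^2$ for $r$ reduced to $(-1/2, 1/2]$, so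
    half of the total, minus $1$, is $1/f(r)$. *)

(** * Means of trigonometric polynomials *)

Section CircleMeans.

Local Open Scope R_scope.

Section RealSums.

Lemma rsum_ext n (f g : nat -> R) :
  (forall i, (i < n)%coq_nat -> f i = g i) -> rsum n f = rsum n g.
Proof.
elim: n => //= n IH h; rewrite IH => [|i hi]; last by apply: h; lia.
by rewrite h //; lia.
Qed.

Lemma rsum_plus n f g : rsum n (fun i => f i + g i) = rsum n f + rsum n g.
Proof. by elim: n => /= [|n ->]; lra. Qed.

Lemma rsum_scal n c f : rsum n (fun i => c * f i) = c * rsum n f.
Proof. by elim: n => /= [|n ->]; lra. Qed.

Lemma rsum_const n c : rsum n (fun _ => c) = INR n * c.
Proof. elim: n => [|n IH]; first by rewrite /=; lra. rewrite S_INR /= IH; lra. Qed.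

Lemma rsum_mul n f g :
  rsum n f * rsum n g = rsum n (fun i => rsum n (fun j => f i * g j)).
Proof.
rewrite Rmult_comm -rsum_scal; apply: rsum_ext => i _.
by rewrite Rmult_comm -rsum_scal.
Qed.

Lemma rsum_delta n (f : nat -> R) j : (j < n)%coq_nat ->
  rsum n (fun i => f i * (if Nat.eq_dec j i then 1 else 0)) = f j.
Proof.
elim: n => [|n IH] /= h; first by lia.
case: (Nat.eq_dec j n) => [jn|jn] /=.
  rewrite jn (rsum_ext (g := fun _ => 0)) ?rsum_const; first lra.
  by move=> i hi; case: Nat.eq_dec => [e|e] /=; [lia|lra].
by rewrite IH; [lra|lia].
Qed.

End RealSums.

(* [mean K g mu]: [g] has mean [mu] on the circle, and the mean over the [N]-th roots of
   unity is also [mu] as soon as [N > K], as happens for trigonometric polynomials of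
   degree at most [K]. *)
Definition mean (K : nat) (g : R -> R) (mu : R) : Prop :=
  is_RInt g 0 (2 * PI) (2 * PI * mu) /\
  forall N, (K < N)%coq_nat ->
    rsum N (fun k => g (2 * PI * INR k / INR N)) = INR N * mu.

Lemma mean_ext K f g mu nu : (forall t, f t = g t) -> mu = nu -> mean K f mu -> mean K g nu.
Proof.
move=> fg <- [h1 h2]; split; first by apply: is_RInt_ext h1 => t _.
by move=> N hN; rewrite -h2 //; apply: rsum_ext.
Qed.

Lemma mean_plus K f g mu nu : mean K f mu -> mean K g nu ->
  mean K (fun t => f t + g t) (mu + nu).
Proof.
move=> [f1 f2] [g1 g2]; split.
  by rewrite Rmult_plus_distr_l; apply: is_RInt_plus.
by move=> N hN; rewrite rsum_plus f2 // g2 // Rmult_plus_distr_l.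
Qed.

Lemma mean_scal K c f mu : mean K f mu -> mean K (fun t => c * f t) (c * mu).
Proof.
move=> [f1 f2]; split.
  have -> : 2 * PI * (c * mu) = scal c (2 * PI * mu).
    by rewrite /scal /= /mult /=; lra.
  exact: is_RInt_scal.
by move=> N hN; rewrite rsum_scal f2 //; lra.
Qed.

Lemma mean_rsum K n (f : nat -> R -> R) mu :
  (forall i, (i < n)%coq_nat -> mean K (f i) (mu i)) ->
  mean K (fun t => rsum n (fun i => f i t)) (rsum n mu).
Proof.
elim: n => [|n IH] h /=; last by apply: mean_plus; [apply: IH => i hi|]; apply: h; lia.
split; last by move=> N _; rewrite rsum_const; lra.
have -> : 2 * PI * 0 = scal (2 * PI - 0) 0 by rewrite /scal /= /mult /=; lra.
exact: is_RInt_const.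
Qed.

(** The Dirichlet kernel, telescoped after multiplication by the sine so that no division by
    [sin (x / 2)] occurs. *)
Lemma sum_cos x N :
  2 * sin (x / 2) * rsum N (fun k => cos (INR k * x)) = sin (INR N * x - x / 2) + sin (x / 2).
Proof.
elim: N => [|N IH].
  rewrite /= (_ : 0 * x - x / 2 = - (x / 2)) ?sin_neg; lra.
rewrite /= Rmult_plus_distr_l IH -/(INR N.+1) S_INR.
have -> : (INR N + 1) * x - x / 2 = INR N * x + x / 2 by lra.
rewrite sin_minus sin_plus; ring.
Qed.

Lemma mean_cos_nat K m : (m <= K)%coq_nat ->
  mean K (fun t => cos (INR m * t)) (if Nat.eq_dec m 0 then 1 else 0).
Proof.
move=> mK; case: Nat.eq_dec => [m0|m0] /=; first rewrite m0.
  apply: (@mean_ext K (fun _ => 1) _ 1) => // [t|]; first by rewrite /= Rmult_0_l cos_0.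
  split; last by move=> N _; rewrite rsum_const.
  have -> : 2 * PI * 1 = scal (2 * PI - 0) 1 by rewrite /scal /= /mult /=; lra.
  exact: is_RInt_const.
have mpos : 0 < INR m by apply: lt_0_INR; lia.
split.
  have -> : 2 * PI * 0 = minus (sin (INR m * (2 * PI)) / INR m) (sin (INR m * 0) / INR m).
    have -> : INR m * (2 * PI) = 0 + 2 * INR m * PI by ring.
    by rewrite sin_period !Rmult_0_r !sin_0 /minus /plus /opp /=; field; lra.
  apply: (is_RInt_derive (fun t => sin (INR m * t) / INR m)) => t _.
    auto_derive => //; field; lra.
  apply: (ex_derive_continuous (fun t => cos (INR m * t))); auto_derive => //.
move=> N KN; rewrite Rmult_0_r.
have N0 : 0 < INR N by apply: lt_0_INR; lia.
pose x := 2 * PI * INR m / INR N.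
rewrite (rsum_ext (g := fun k => cos (INR k * x))); last first.
  by move=> k _; congr cos; rewrite /x; field; lra.
have := sum_cos x N.
(* [INR N * x] is a whole number of periods, so the closed form vanishes; $0 < m < N$ keeps the
   factor [sin (x / 2)] away from zero. *)
have -> : INR N * x - x / 2 = - (x / 2) + 2 * INR m * PI by rewrite /x; field; lra.
rewrite sin_period sin_neg => h.
have s0 : 0 < sin (x / 2).
  have -> : x / 2 = PI * (INR m / INR N) by rewrite /x; field; lra.
  have mN : INR m < INR N by apply: lt_INR; lia.
  have pi := PI_RGT_0.
  have q1 : 0 < INR m / INR N by apply: Rdiv_lt_0_compat.
  have q2 : INR m / INR N < 1 by apply/Rlt_div_l; lra.
  by apply: sin_gt_0; nra.
have : 2 * sin (x / 2) * rsum N (fun k => cos (INR k * x)) = 0 by lra.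
by move/Rmult_integral => []; lra.
Qed.

Lemma mean_cos K (z : Z) : (Z.abs z <= Z.of_nat K)%Z ->
  mean K (fun t => cos (IZR z * t)) (if Z.eq_dec z 0 then 1 else 0).
Proof.
move=> zK; have h : (Z.abs_nat z <= K)%coq_nat by lia.
apply: mean_ext (mean_cos_nat h) => [t|]; last first.
  by case: Nat.eq_dec => e; case: Z.eq_dec => e' //=; lia.
rewrite INR_IZR_INZ Zabs2Nat.id_abs; case: (Z.abs_eq_or_opp z) => -> //.
by rewrite opp_IZR Ropp_mult_distr_l_reverse cos_neg.
Qed.

(** * Norms of polynomials from samples at roots of unity *)

Definition poly_sq (n : nat) (a : nat -> R) (t : R) : R :=
  poly_re n a t ^ 2 + poly_im n a t ^ 2.

Lemma poly_sqE n a t : poly_sq n a t =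
  rsum n (fun j => rsum n (fun k => a j * a k * cos (IZR (Z.of_nat j - Z.of_nat k) * t))).
Proof.
rewrite /poly_sq /poly_re /poly_im.
rewrite /= !Rmult_1_r !rsum_mul -rsum_plus; apply: rsum_ext => j _.
rewrite -rsum_plus; apply: rsum_ext => k _.
rewrite minus_IZR -!INR_IZR_INZ Rmult_minus_distr_r cos_minus; ring.
Qed.

Lemma mean_poly_sq n a : mean n (poly_sq n a) (rsum n (fun j => a j ^ 2)).
Proof.
apply: mean_ext (fun t => esym (poly_sqE n a t)) _ (mean_rsum (fun j hj => mean_rsum (fun k hk =>
  mean_scal (a j * a k) (@mean_cos n (Z.of_nat j - Z.of_nat k) _)))); last by lia.
apply: rsum_ext => j hj; transitivity (a j * a j); last by ring.
rewrite -[RHS](rsum_delta (fun k => a j * a k) hj); apply: rsum_ext => k _.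
by case: Z.eq_dec => e; case: Nat.eq_dec => e' //=; lia.
Qed.

(** The frequencies of $|A|^4$ are at most $2n - 2$, so $2n$ nodes see the true mean. Its value is
    left existential: only the equality of integral and sample mean matters. *)
Lemma mean_poly_sq_sqr n a : (0 < n)%coq_nat ->
  exists mu, mean (2 * n - 1) (fun t => poly_sq n a t ^ 2) mu.
Proof.
move=> n0.
pose c (z : Z) t := cos (IZR z * t).
pose d j k := (Z.of_nat j - Z.of_nat k)%Z.
pose f j k j' k' t := a j * a k * (a j' * a k') / 2 *
  (c (d j k + d j' k')%Z t + c (d j k - d j' k')%Z t).
have fE t : rsum n (fun j => rsum n (fun j' => rsum n (fun k => rsum n (fun k' => f j k j' k' t)))) =
    poly_sq n a t ^ 2.
  rewrite poly_sqE (_ : forall x, x ^ 2 = x * x); last by move=> x; ring.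
  rewrite rsum_mul; apply: rsum_ext => j _; apply: rsum_ext => j' _.
  rewrite rsum_mul; apply: rsum_ext => k _; apply: rsum_ext => k' _.
  rewrite /f /c -/(d j k) -/(d j' k').
  move: (d j k) (d j' k') => u u'; rewrite plus_IZR minus_IZR.
  rewrite Rmult_plus_distr_r Rmult_minus_distr_r cos_plus cos_minus.
  by field.
eexists; apply: mean_ext fE erefl _.
apply: mean_rsum => j hj; apply: mean_rsum => j' hj'; apply: mean_rsum => k hk; apply: mean_rsum => k' hk'.
by apply: mean_scal; apply: mean_plus; apply: mean_cos; rewrite /d;
  move: hj hj' hk hk' n0; clear; lia.
Qed.

Lemma mean_L4 n a : (0 < n)%coq_nat ->
  / (2 * PI) * RInt (fun t => poly_sq n a t ^ 2) 0 (2 * PI) =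
  / (2 * INR n) * rsum (2 * n) (fun k => poly_sq n a (PI * INR k / INR n) ^ 2).
Proof.
move=> n0; have [mu [h1 h2]] := mean_poly_sq_sqr a n0.
have pi := PI_RGT_0; have n0' : 0 < INR n by apply: lt_0_INR.
rewrite (is_RInt_unique _ _ _ _ h1).
have i2 : INR (2 * n)%N = 2 * INR n by rewrite (mult_INR 2 n).
have := h2 (2 * n)%N ltac:(lia); rewrite i2 => h.
rewrite (rsum_ext (g := fun k => poly_sq n a (2 * PI * INR k / (2 * INR n)) ^ 2)) ?h.
  by field; lra.
by move=> k _; do 2 congr (_ ^ _) || congr poly_sq; field; lra.
Qed.

Lemma poly_sq_ge0 n a t : 0 <= poly_sq n a t.
Proof. rewrite /poly_sq; nra. Qed.

Lemma rpow_sqrt_2 x : 0 <= x -> rpow (sqrt x) 2 = x.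
Proof.
move=> x0; rewrite /rpow; case: Rlt_dec => s /=.
  by rewrite (_ : 2 = INR 2) // Rpower_pow //= Rmult_1_r sqrt_sqrt.
have := sqrt_pos x => ?; have e : sqrt x = 0 by lra.
by rewrite -(sqrt_sqrt x) // e; ring.
Qed.

Lemma rpow_sqrt_4 x : 0 <= x -> rpow (sqrt x) 4 = x ^ 2.
Proof.
move=> x0; have := sqrt_sqrt x x0; rewrite /rpow; case: Rlt_dec => s /= e.
  rewrite (_ : 4 = INR 4); last by rewrite /=; ring.
  by rewrite Rpower_pow //; move: (sqrt x) e => y <-; ring.
have := sqrt_pos x => ?; have e0 : sqrt x = 0 by lra.
by rewrite -e e0; ring.
Qed.

Lemma rpow_inv_pow x k : (0 < k)%coq_nat -> 0 <= x -> rpow x (/ INR k) ^ k = x.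
Proof.
move=> k0 x0; rewrite /rpow; case: Rlt_dec => s /=.
  rewrite -Rpower_pow; last exact: exp_pos.
  rewrite Rpower_mult Rinv_l ?Rpower_1 //; apply: not_0_INR; lia.
by rewrite pow_i //; lra.
Qed.

Lemma meritE n a : (0 < n)%coq_nat -> rsum n (fun j => a j ^ 2) = INR n ->
  merit n a = INR n ^ 2 / (/ (2 * INR n) *
    rsum (2 * n) (fun k => poly_sq n a (PI * INR k / INR n) ^ 2) - INR n ^ 2).
Proof.
move=> n0 an; have pi := PI_RGT_0; have n0' : 0 < INR n by apply: lt_0_INR.
have L2 : Lnorm 2 n a ^ 4 = INR n ^ 2.
  rewrite /Lnorm (RInt_ext _ (poly_sq n a)); last first.
    by move=> t _; rewrite /poly_abs rpow_sqrt_2 //; exact: poly_sq_ge0.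
  have [h1 _] := mean_poly_sq n a; rewrite (is_RInt_unique _ _ _ _ h1) an.
  have -> : / (2 * PI) * (2 * PI * INR n) = INR n by field; lra.
  have := @rpow_inv_pow (INR n) 2 ltac:(lia) ltac:(lra).
  by rewrite (_ : INR 2 = 2) // => {2}<-; ring.
have L4 : Lnorm 4 n a ^ 4 = / (2 * INR n) *
    rsum (2 * n) (fun k => poly_sq n a (PI * INR k / INR n) ^ 2).
  rewrite /Lnorm (RInt_ext _ (fun t => poly_sq n a t ^ 2)); last first.
    by move=> t _; rewrite /poly_abs rpow_sqrt_4 //; exact: poly_sq_ge0.
  rewrite mean_L4 //; have -> : / 4 = / INR 4 by congr (/ _); rewrite /=; ring.
  apply: rpow_inv_pow; first by lia.
  apply: Rmult_le_pos; first by apply/Rlt_le/Rinv_0_lt_compat; lra.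
  elim: (2 * n)%N => /= [|k IH]; first lra.
  by apply: Rplus_le_le_0_compat => //; nra.
by rewrite /merit L2 L4.
Qed.

(* With [t] the residue of [- 2 floor (n r)] modulo [n], the ratio [(2 t + 2 - n) / n] tends
   to a triangle wave in [r]. *)
Lemma triangle_wave (D r rho t : R) (f k m : Z) : 2 <= D ->
  IZR f <= D * r -> D * r < IZR f + 1 -> 0 <= t -> t + 1 <= D ->
  t = - 2 * IZR f + D * IZR k -> rho = r + IZR m -> - / 2 <= rho -> rho <= / 2 ->
  16 * (Rabs rho - / 4) ^ 2 - 12 / D <= ((2 * t + 2 - D) / D) ^ 2.
Proof.
move=> D2 f1 f2 t0 tD tE rE r1 r2.
pose th := D * r - IZR f; pose E := / D.
have E0 : 0 < E by apply: Rinv_0_lt_compat; lra.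
have DE : D * E = 1 by rewrite /E; field; lra.
have E2 : E <= / 2 by apply: Rinv_le_contravar; lra.
pose k' := (k + 2 * m)%Z.
have kE : IZR k' = IZR k + 2 * IZR m by rewrite /k' plus_IZR mult_IZR.
have tDE : t * E = - 2 * rho + IZR k' + 2 * th * E.
  rewrite tE kE rE /th.
  have -> : (- 2 * IZR f + D * IZR k) * E = - 2 * IZR f * E + IZR k * (D * E) by ring.
  have -> : 2 * (D * r - IZR f) * E = 2 * r * (D * E) - 2 * IZR f * E by ring.
  by rewrite DE; ring.
have th0 : 0 <= th by rewrite /th; lra.
have th1 : th < 1 by rewrite /th; lra.
have u0 : 0 <= th * E by nra.
have u1 : th * E <= E by nra.
have u2 : th * E < / 2 by nra.
have tE0 : 0 <= t * E by nra.
have tE1 : t * E < 1 by nra.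
have kl : (-2 < k')%Z by apply: lt_IZR; lra.
have ku : (k' < 2)%Z by apply: lt_IZR; lra.
set X := (2 * t + 2 - D) / D.
have XE : X = - 4 * rho + 2 * IZR k' - 1 + (4 * (th * E) + 2 * E).
  have -> : X = 2 * (t * E) + 2 * E - D * E by rewrite /X /Rdiv -/E; ring.
  by rewrite tDE DE; ring.
have -> : 12 / D = 12 * E by [].
pose a := Rabs (4 * Rabs rho - 1).
have aE : 16 * (Rabs rho - / 4) ^ 2 = a ^ 2.
  rewrite /a pow2_abs; field.
have a0 : 0 <= a by apply: Rabs_pos.
have a1 : a <= 1 by rewrite /a /Rabs; repeat case: Rcase_abs => ?; lra.
(* The shift [4 * (th * E) + 2 * E] is at most [6 * E]. Squaring then costs at most [12 * E],
   because [a <= 1]. *)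
have Xa : a - 6 * E <= Rabs X.
  have : k' = (-1)%Z \/ k' = 0%Z \/ k' = 1%Z by lia.
  by case=> [h|[h|h]]; rewrite h in XE tDE; rewrite XE /a /Rabs; repeat case: Rcase_abs => ?; lra.
rewrite aE -(pow2_abs X); have := Rabs_pos X; move: (Rabs X) Xa => Y Ya Y0.
case: (Rle_lt_dec (6 * E) a) => c; nra.
Qed.

(** Meant for [k] the number of prime factors of [n] and [p] the least one. It rests on $\ln 2 >
    1/2$ and on $\ln n \ge 1$ for $n \ge 3$. *)
Lemma log_over_prime (n p k : nat) (eps : R) : (2 < n)%N -> (0 < p)%N -> (2 ^ k <= n)%N ->
  ln (INR n) ^ 7 / INR p < eps -> INR k / INR p <= 2 * eps /\ / INR p < eps.
Proof.
move=> n2 p0 kn h.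
have p0' : 0 < / INR p by apply/Rinv_0_lt_compat/lt_0_INR; lia.
have n3 : 3 <= INR n by rewrite (_ : 3 = INR 3); [apply: le_INR; lia | rewrite /=; ring].
have l1 : 1 <= ln (INR n).
  rewrite -(ln_exp 1); apply: ln_le; first exact: exp_pos.
  by apply: Rle_trans exp_le_3 n3.
have l2 : ln (INR n) <= ln (INR n) ^ 7.
  have := pow_R1_Rle (ln (INR n)) 6 l1 => h6.
  by rewrite (_ : ln (INR n) ^ 7 = ln (INR n) * ln (INR n) ^ 6); [nra | rewrite /=; ring].
have kl : INR k <= 2 * ln (INR n).
  have : ln (2 ^ k) <= ln (INR n).
    apply: ln_le; first by apply: pow_lt; lra.
    have -> : 2 ^ k = INR (expn 2 k).
      by elim: (k) => [|i IH]; [|rewrite expnS mult_INR -IH].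
    by apply: le_INR; apply/leP.
  rewrite ln_pow; last lra.
  by have := ln_lt_2; have := pos_INR k; nra.
by rewrite /Rdiv in h *; split; nra.
Qed.

End CircleMeans.

From mathcomp Require Import all_boot all_order all_algebra all_fingroup all_solvable.
From mathcomp Require Import all_field complex Rstruct ring lra.

Import Order.TTheory GRing.Theory Num.Theory Normc.

Local Open Scope ring_scope.

(** * Quadratic character sums over a finite field *)

Lemma mulr_sum2 (R : comPzRingType) (I : finType) (f g : I -> R) :
  (\sum_i f i) * (\sum_i g i) = \sum_a \sum_b f a * g b.
Proof. exact: big_distrlr. Qed.

Lemma mulr_sum4 (R : comPzRingType) (I : finType) (f g h k : I -> R) :
  (\sum_i f i) * (\sum_i g i) * (\sum_i h i) * (\sum_i k i) =
  \sum_a \sum_b \sum_c \sum_d f a * g b * h c * k d.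
Proof.
rewrite !mulr_suml; apply: eq_bigr => a _.
rewrite [f a * _]mulr_sumr !mulr_suml; apply: eq_bigr => b _.
by rewrite [f a * g b * _]mulr_sumr mulr_suml; apply: eq_bigr => c _; rewrite mulr_sumr.
Qed.


(** The quadruples of shifts for which $(x+a)(x+b)(x+c)(x+d)$ is a square, so that the complete
    character sum is large; all others give cancellation. *)
Definition paired (T : eqType) (a b c d : T) :=
  [|| (a == b) && (c == d), (a == c) && (b == d) | (a == d) && (b == c)].

Section QuadraticCharacter.

Variable F : finFieldType.
Hypothesis oddF : odd #|F|.

Definition qchar (x : F) : int :=
  if x == 0 then 0 else if [exists y, y ^+ 2 == x] then 1 else -1.

Lemma qchar0 : qchar 0 = 0.
Proof. by rewrite /qchar eqxx. Qed.

Lemma qchar_eq0 x : (qchar x == 0) = (x == 0).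
Proof. by rewrite /qchar; case: (x =P 0) => // _; case: ifP. Qed.

Lemma qchar_sqr x : qchar x ^+ 2 = (x != 0)%:R.
Proof. by rewrite /qchar; case: (x =P 0) => // _; case: ifP. Qed.

Lemma qchar_norm x : `|qchar x| <= 1.
Proof. by rewrite /qchar; case: (x =P 0) => // _; case: ifP. Qed.

(** A generator of the cyclic unit group turns the character into the parity of an exponent;
    multiplicativity and the vanishing of the full sum both follow from this. *)
Lemma qchar_generator : exists2 g : F,
  (forall x, x != 0 -> exists i : nat, x = g ^+ i) &
  (forall i : nat, qchar (g ^+ i) = (-1) ^+ i).
Proof.
have /cyclicP[g gE] := field_unit_group_cyclic [group of [set: {unit F}]].
have og : #[g]%g = #|F|.-1 by rewrite orderE -gE card_finField_unit.
have xE i : val (g ^+ i)%g = val g ^+ i.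
  by elim: i => // i IH; rewrite expgS /= IH exprS.
have gen x : x != 0 -> exists i : nat, x = val g ^+ i.
  move=> x0; have : FinRing.unit F (etrans (unitfE x) x0) \in <[g]>%g.
    by rewrite -gE inE.
  by case/cycleP => i /(congr1 val) /=; rewrite xE; exists i.
exists (val g) => // i.
have g0 : val g != 0 by rewrite -unitfE (valP g).
rewrite /qchar expf_eq0 (negPf g0) andbF -signr_odd.
case: existsP => [[y /eqP yx]|].
  have y0 : y != 0.
    by apply: contraNneq (expf_neq0 i g0) => y0; rewrite -yx y0 expr0n.
  have [j yj] := gen _ y0.
  have: (g ^+ (j * 2) == g ^+ i)%g.
    by apply/eqP/val_inj; rewrite !xE exprM -yj yx.
  rewrite eq_expg_mod_order og => /eqP eqij.
  (* The group order is even, so exponents of the same element have the same parity. *)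
  have ev : (2 %| #|F|.-1)%N.
    by rewrite dvdn2; move: oddF; case: #|F|.
  have : (j * 2 = i %[mod 2])%N.
    by rewrite -(modn_dvdm (j*2) ev) eqij modn_dvdm.
  by rewrite modnMl !modn2; case: (odd i).
move=> nsq; case: (boolP (odd i)) => // /negbTE oi; case: nsq.
exists (val g ^+ i./2); apply/eqP; rewrite -exprM; congr (_ ^+ _).
by rewrite muln2 -[RHS]odd_double_half oi.
Qed.

Lemma qcharM x y : qchar (x * y) = qchar x * qchar y.
Proof.
have [->|x0] := eqVneq x 0; first by rewrite mul0r qchar0 mul0r.
have [->|y0] := eqVneq y 0; first by rewrite mulr0 qchar0 mulr0.
have [g gen gX] := qchar_generator.
by have [i ->] := gen _ x0; have [j ->] := gen _ y0; rewrite -exprD !gX exprD.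
Qed.

Lemma sum_qchar : \sum_(x : F) qchar x = 0.
Proof.
have [g gen gX] := qchar_generator.
have g0 : g != 0 by rewrite -qchar_eq0 -[g]expr1 gX.
have: \sum_(x : F) qchar x = \sum_(x : F) qchar (g * x).
  rewrite [LHS](reindex (fun x => g * x)) //; apply: onW_bij.
  by exists (fun x => g^-1 * x) => x; field.
under [in RHS]eq_bigr do rewrite qcharM -[X in qchar X]expr1 gX.
by rewrite -mulr_sumr expr1 mulN1r; move: (\sum_x _) => S; lia.
Qed.

Lemma sum_qchar_affine (t u : F) : t != 0 -> \sum_(x : F) qchar (t * x + u) = 0.
Proof.
move=> t0; transitivity (\sum_(x : F) qchar x); last exact: sum_qchar.
rewrite [RHS](reindex (fun x => t * x + u)) //.
by apply: onW_bij; exists (fun y => (y - u) / t) => x; field.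
Qed.

Lemma sum_neq0_inv (V : nmodType) (f : F -> V) :
  \sum_(x | x != 0) f x^-1 = \sum_(x | x != 0) f x.
Proof.
rewrite [RHS](reindex_inj invr_inj); apply: eq_bigl => x.
by rewrite invr_eq0.
Qed.

(** After a translation the summand at $x \ne 0$ is $\chi(x)\chi(x+d) = \chi(1 + d/x)$, and
    inverting $x$ leaves a linear sum with the single term at $0$ missing. *)
Lemma norm_sum_qchar2 (a b : F) : a != b ->
  `|\sum_(x : F) qchar (x + a) * qchar (x + b)| <= 1.
Proof.
move=> nab; rewrite (reindex_inj (addIr (- a))) /=.
pose d := b - a; have d0 : d != 0 by rewrite subr_eq0 eq_sym.
under eq_bigr do rewrite addrNK -addrA [- a + b]addrC -/d.
rewrite (bigD1 0) //= qchar0 mul0r add0r.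
rewrite (eq_bigr (fun x => qchar (d * x^-1 + 1))); last first.
  move=> x x0; rewrite -qcharM -[RHS]mul1r -[1](_ : qchar x ^+ 2 = 1).
    by rewrite -mulrA -!qcharM; congr qchar; field.
  by rewrite qchar_sqr x0.
rewrite (sum_neq0_inv (fun x => qchar (d * x + 1))).
have := sum_qchar_affine 1 d0; rewrite (bigD1 0) //= mulr0 add0r.
by move/eqP; rewrite addrC addr_eq0 => /eqP ->; rewrite normrN qchar_norm.
Qed.

(** Row vectors of length 4 encode the polynomials of degree at most three: a finite type over which
    to average. *)
Definition qsum (f : 'rV[F]_4) : int := \sum_x qchar (rVpoly f).[x].

(** A cubic vanishing at [y], [z], [t] but not at [x] can be added to [f] with any coefficient [s]:
    only the value at [x] moves, and summing over [s] gives a full linear character sum. Three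
    points to fix is what makes degree three the right family for a fourth moment. *)
Lemma qchar_isolated (x y z t : F) : x != y -> x != z -> x != t ->
  \sum_(f : 'rV[F]_4) qchar (rVpoly f).[x] * qchar (rVpoly f).[y] *
     qchar (rVpoly f).[z] * qchar (rVpoly f).[t] = 0.
Proof.
move=> xy xz xt; pose g := ('X - y%:P) * ('X - z%:P) * ('X - t%:P).
pose h : 'rV[F]_4 := poly_rV g.
have gh : rVpoly h = g.
  have gE : g = \prod_(a <- [:: y; z; t]) ('X - a%:P).
    by rewrite !big_cons big_nil mulr1 mulrA.
  by rewrite poly_rV_K // gE size_prod_XsubC.
set I := \sum_f _.
have sh (s : F) : I = \sum_(f : 'rV[F]_4) qchar (g.[x] * s + (rVpoly f).[x]) *
   qchar (rVpoly f).[y] * qchar (rVpoly f).[z] * qchar (rVpoly f).[t].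
  rewrite /I (reindex_inj (addrI (s *: h))); apply: eq_bigr => f _.
  by rewrite !linearD !linearZ /= gh !hornerE /=; congr (qchar _ * qchar _ * qchar _ * qchar _); ring.
have: I *+ #|F| = 0.
  rewrite -sumr_const; under eq_bigr => s _ do rewrite (sh s).
  rewrite exchange_big big1 //= => f _.
  rewrite -!mulr_suml sum_qchar_affine ?mul0r //.
  by rewrite /g !hornerE !mulf_neq0 ?subr_eq0.
move/eqP; rewrite mulrn_eq0 => /orP[|/eqP //].
by move: oddF; case: #|F|.
Qed.

(** In an unpaired quadruple some point differs from the other three, and [qchar_isolated] removes
    it. At most $3p^2$ paired quadruples remain, each bounded by the number $p^4$ of vectors. *)
Lemma qsum_moment4 : \sum_f qsum f ^+ 4 <= (3 * #|F| ^ 6)%:R.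
Proof.
have card4 : #|{: 'rV[F]_4}| = (#|F| ^ 4)%N by rewrite card_mx.
under eq_bigr do rewrite !exprS expr0 mulr1 !mulrA mulr_sum4.
rewrite exchange_big /=; under eq_bigr do rewrite exchange_big /=.
under eq_bigr do under eq_bigr do rewrite exchange_big /=.
under eq_bigr do under eq_bigr do under eq_bigr do rewrite exchange_big /=.
have bnd x y z t : \sum_(f : 'rV[F]_4) qchar (rVpoly f).[x] * qchar (rVpoly f).[y] *
     qchar (rVpoly f).[z] * qchar (rVpoly f).[t] <=
   (#|F| ^ 4)%:R * (((x == y) && (z == t))%:R + ((x == z) && (y == t))%:R
     + ((x == t) && (y == z))%:R).
  set I := \sum_f _.
  have triv : I <= (#|F| ^ 4)%:R.
    rewrite -card4 -sumr_const; apply: ler_sum => f _.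
    apply: le_trans (ler_norm _) _; rewrite !normrM.
    by rewrite !mulr_ile1 ?mulr_ge0 ?normr_ge0 ?qchar_norm.
  case: (boolP ([|| (x == y) && (z == t), (x == z) && (y == t)
                  | (x == t) && (y == z)])) => [pr|npr].
    apply: le_trans triv _; rewrite ler_peMr ?ler0n //.
    by case/or3P: pr => ->; rewrite -!natrD ler1n; lia.
  have -> : I = 0; last by rewrite mulr_ge0 ?addr_ge0 ?ler0n.
  move: npr; rewrite !negb_or !negb_and.
  have [xy|xy] /= := eqVneq x y.
    move=> /andP[zt _]; have [xz|xz] := eqVneq x z.
      apply: etrans (qchar_isolated (x := t) (y := x) (z := y) (t := z) _ _ _);
        [by apply: eq_bigr => f _; ring | | | ]; by rewrite eq_sym -?xy ?xz.
    apply: etrans (qchar_isolated (x := z) (y := x) (z := y) (t := t) _ _ _) => //;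
      [by apply: eq_bigr => f _; ring | | ]; by rewrite eq_sym -?xy.
  have [xz|xz] /= := eqVneq x z.
    move=> /andP[yt _].
    apply: etrans (qchar_isolated (x := y) (y := x) (z := z) (t := t) _ _ _) => //;
      [by apply: eq_bigr => f _; ring | | ]; by rewrite eq_sym -?xz.
  have [xt|xt] /= := eqVneq x t; last by move=> _; exact: qchar_isolated.
  move=> yz.
  apply: etrans (qchar_isolated (x := y) (y := x) (z := z) (t := t) _ _ _) => //;
    [by apply: eq_bigr => f _; ring | | ]; by rewrite eq_sym -?xt.
apply: le_trans (_ : \sum_(x : F) \sum_(y : F) \sum_(z : F) \sum_(t : F)
   (#|F| ^ 4)%:R * (((x == y) && (z == t))%:R + ((x == z) && (y == t))%:R
     + ((x == t) && (y == z))%:R) <= _).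
  by apply: ler_sum => x _; apply: ler_sum => y _; apply: ler_sum => z _;
     apply: ler_sum => t _; apply: bnd.
have dl (z : F) (b : bool) : \sum_(t : F) (b && (z == t))%:R = b%:R :> int.
  by rewrite (bigD1 z) //= eqxx andbT big1 ?addr0 // => i /negPf;
     rewrite eq_sym => ->; rewrite andbF.
have dl' (z : F) (b : bool) : \sum_(t : F) ((z == t) && b)%:R = b%:R :> int.
  by under eq_bigr do rewrite andbC; exact: dl.
have dl1 (z : F) : \sum_(t : F) (z == t)%:R = 1 :> int by rewrite -[RHS](dl z true).
rewrite le_eqVlt; apply/orP; left; apply/eqP.
under eq_bigr do under eq_bigr do under eq_bigr do
  rewrite -mulr_sumr !big_split /= !dl dl'.
under eq_bigr do under eq_bigr do rewrite -mulr_sumr !big_split /= !dl1 sumr_const.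
under eq_bigr do rewrite -mulr_sumr !big_split /= !sumrMnl dl1 !sumr_const.
rewrite sumr_const -[LHS]mulr_natr natrX natrM natrX.
by move: #|F| => p; ring.
Qed.

Lemma card_roots_cubic (f : 'rV[F]_4) : rVpoly f != 0 ->
  \sum_(r : F) (root (rVpoly f) r)%:R <= 3%:R :> int.
Proof.
move=> f0; pose Z := [pred r | root (rVpoly f) r].
rewrite -natr_sum ler_nat (_ : (\sum_r _)%N = #|Z|); last first.
  by rewrite -sum1_card [RHS]big_mkcond; apply: eq_bigr => r _; rewrite inE; case: root.
have sz : (size (rVpoly f) <= 4)%N by exact: size_poly.
rewrite -ltnS cardE; apply: leq_trans sz.
by rewrite max_poly_roots ?enum_uniq //; apply/allP => r; rewrite mem_enum.
Qed.

(* The orbit of [f] under [x |-> t x + u] and scaling by [c] has about [p^3] members, all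
   with the same [|qsum|]; a member is recovered from its coefficients and the images of
   the roots [d], [e], so it is counted at most nine times. *)
Lemma sum_qchar_cubic (f : {poly F}) (d e : F) :
  size f = 4 -> root f d -> root f e -> d != e ->
  (\sum_x qchar f.[x]) ^+ 4 * (#|F|.-1 ^ 2 * #|F|)%:R <= (27 * #|F| ^ 6)%:R.
Proof.
move=> sf fd fe de; set T := \sum_x _.
pose g (k : F * F * F) : {poly F} := k.1.1 *: (f \Po (k.1.2 *: 'X + k.2%:P)).
pose D := [set k : F * F * F | (k.1.1 != 0) && (k.1.2 != 0)].
pose ph (k : F * F * F) : 'rV[F]_4 * (F * F) :=
  (poly_rV (g k), ((d - k.2) / k.1.2, (e - k.2) / k.1.2)).
pose H (y : 'rV[F]_4 * (F * F)) : int :=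
  (root (rVpoly y.1) y.2.1)%:R * (root (rVpoly y.1) y.2.2)%:R * qsum y.1 ^+ 4.
have H0 y : 0 <= H y by rewrite /H mulr_ge0 ?exprn_even_ge0 // mulr_ge0 ?ler0n.
have sz2 (t u : F) : t != 0 -> size (t *: 'X + u%:P) = 2.
  move=> t0; rewrite size_polyDl size_scale ?size_polyX //.
  exact: leq_ltn_trans (size_polyC_leq1 u) _.
have szc (k : F * F * F) : k \in D -> size (f \Po (k.1.2 *: 'X + k.2%:P)) = 4.
  by rewrite inE => /andP[_ t0]; rewrite size_comp_poly2 ?sz2.
have gK k : k \in D -> rVpoly (poly_rV (g k) : 'rV_4) = g k.
  move=> kD; rewrite poly_rV_K // size_scale ?szc //.
  by move: kD; rewrite inE => /andP[].
have gE k x : (g k).[x] = k.1.1 * f.[k.1.2 * x + k.2].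
  by rewrite /g hornerZ horner_comp !hornerE.
have phI : {in D &, injective ph}.
  move=> [[c t] u] [[c' t'] u'] kD kD' [] /(congr1 (@rVpoly F 4)).
  rewrite !gK //= => Eg E1 E2.
  move: (kD) (kD'); rewrite !inE /= => /andP[c0 t0] /andP[c0' t0'].
  have Et : t = t'.
    have: (d - e) / t = (d - e) / t'.
      transitivity ((d - u) / t - (e - u) / t); first by field.
      by rewrite E1 E2; field.
    by move/mulfI; rewrite subr_eq0 => /(_ de) /invr_inj.
  have Eu : u = u'.
    move: E1; rewrite -Et => /(mulIf _) /=; rewrite invr_eq0 => /(_ t0).
    by move/addrI/oppr_inj.
  move: Eg; rewrite /g /= -Et -Eu => /eqP; rewrite -subr_eq0 -scalerBl scaler_eq0.
  case/orP => [|/eqP h0]; first by rewrite subr_eq0 => /eqP ->.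
  by have := szc _ kD; rewrite /= h0 size_poly0.
have Hph k : k \in D -> H (ph k) = T ^+ 4.
  move=> kD; have := kD; rewrite inE => /andP[c0 t0].
  rewrite /H /= gK // !rootE !gE.
  rewrite ![k.1.2 * _]mulrC !divfK // !subrK (eqP fd) (eqP fe) mulr0 eqxx !mul1r.
  have -> : qsum (poly_rV (g k)) = qchar k.1.1 * T.
    rewrite /qsum gK // /T [in RHS](reindex (fun x => k.1.2 * x + k.2)) /=.
      by rewrite mulr_sumr; apply: eq_bigr => x _; rewrite gE qcharM.
    apply: onW_bij; exists (fun y => (y - k.2) / k.1.2) => x; by field.
  by rewrite exprMn -[4%N]/(2 * 2)%N exprM qchar_sqr c0 expr1n mul1r.
have cardD : #|D| = (#|F|.-1 ^ 2 * #|F|)%N.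
  have -> : D = setX (setX [set~ 0] [set~ 0]) [set: F].
    by apply/setP => -[[c t] u]; rewrite !inE andbT.
  by rewrite !cardsX cardsC1 cardsT mulnn.
have E : \sum_(k in D) H (ph k) = T ^+ 4 * (#|F|.-1 ^ 2 * #|F|)%:R.
  rewrite (eq_bigr (fun=> T ^+ 4)) => [|k kD]; last exact: Hph.
  by rewrite sumr_const cardD mulr_natr.
rewrite -E -(big_imset H phI) /=.
apply: le_trans (_ : \sum_y H y <= _).
  by rewrite [leRHS](bigID (fun y => y \in ph @: D)) /= lerDl sumr_ge0.
apply: le_trans (_ : 9%:R * \sum_f qsum f ^+ 4 <= _); last first.
  have := qsum_moment4; set M := \sum_f _ => ?.
  by rewrite (_ : (27 * _)%:R = 9%:R * (3 * #|F| ^ 6)%:R :> int) ?ler_pM2l // -natrM mulnA.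
rewrite -(pair_bigA _ (fun f (y : F * F) => H (f, y))) /= mulr_sumr.
apply: ler_sum => h _.
rewrite -(pair_bigA _ (fun x y => H (h, (x, y)))) /= /H /=.
(* The zero polynomial has every element as a root, but its [qsum] is zero. *)
have [h0|h0] := eqVneq (rVpoly h) 0.
  have -> : qsum h = 0 by rewrite /qsum big1 // => x _; rewrite h0 horner0 qchar0.
  by rewrite expr0n /= mulr0 big1 // => x _; rewrite big1 // => y _; rewrite mulr0.
under eq_bigr do rewrite -mulr_suml -mulr_sumr.
rewrite -mulr_suml -mulr_suml; apply: ler_wpM2r; first by rewrite exprn_even_ge0.
rewrite (_ : 9%:R = 3%:R * 3%:R :> int) //.
by rewrite ler_pM ?card_roots_cubic // sumr_ge0.
Qed.

(* Inverting about the root [- a] turns the quartic sum into a cubic one. *)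
Lemma sum_qchar4 (a b c d : F) : uniq [:: a; b; c; d] ->
  (\sum_x qchar (x + a) * qchar (x + b) * qchar (x + c) * qchar (x + d)) ^+ 4
    <= (1000 * #|F| ^ 3)%:R.
Proof.
rewrite /= !inE !negb_or !andbT => /andP[/and3P[ab ac ad] /andP[/andP[bc bd] cd]].
rewrite (reindex_inj (addIr (- a))) /=.
under eq_bigr do rewrite addrNK -!addrA ![- a + _]addrC.
rewrite (bigD1 0) //= qchar0 !mul0r add0r.
have b0 : b - a != 0 by rewrite subr_eq0 eq_sym.
have c0 : c - a != 0 by rewrite subr_eq0 eq_sym.
have d0 : d - a != 0 by rewrite subr_eq0 eq_sym.
have bc' : b - a != c - a by rewrite (inj_eq (addIr _)).
move: (b - a) (c - a) (d - a) b0 c0 d0 bc' => {ab ac ad bc bd cd b c d}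
  b c d b0 c0 d0 bc.
pose f := (b *: 'X + 1%:P) * (c *: 'X + 1%:P) * (d *: 'X + 1%:P).
have sz t : t != 0 -> size (t *: 'X + 1%:P : {poly F}) = 2.
  by move=> t0; rewrite size_polyDl size_scale ?size_polyX // size_polyC oner_eq0.
have nz t : t != 0 -> t *: 'X + 1%:P != 0 :> {poly F}.
  by move=> t0; rewrite -size_poly_eq0 sz.
have sf : size f = 4 by rewrite /f !size_mul ?mulf_neq0 ?nz // !sz.
have fE x : f.[x] = (b * x + 1) * (c * x + 1) * (d * x + 1) by rewrite !hornerE.
have fb : root f (- b^-1) by rewrite rootE fE mulrN divff // addNr !mul0r.
have fc : root f (- c^-1) by rewrite rootE fE [c * - _]mulrN divff // addNr mulr0 mul0r.
have bc1 : - b^-1 != - c^-1 by rewrite (inj_eq oppr_inj) (inj_eq invr_inj).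
have := sum_qchar_cubic sf fb fc bc1; set T := \sum_x _ => HT.
rewrite (eq_bigr (fun x => qchar f.[x^-1])); last first.
  move=> x x0; have x4 : qchar x ^+ 4 = 1.
    by rewrite -[4%N]/(2 * 2)%N exprM qchar_sqr x0 expr1n.
  by rewrite -[RHS]mul1r -x4 !exprS expr0 mulr1 -!qcharM fE; congr qchar; field.
rewrite (sum_neq0_inv (fun x => qchar f.[x])).
have -> : \sum_(x | x != 0) qchar f.[x] = T - qchar f.[0].
  by rewrite /T [in RHS](bigD1 0) //= addrAC subrr add0r.
have p2 : (1 < #|F|)%N := finNzRing_gt1 F.
(* Here $(p-1)^2 p \ge p^3/4$, and $108 = 4 \cdot 27$. *)
have T4 : T ^+ 4 <= (108 * #|F| ^ 3)%:R.
  have T0 : 0 <= T ^+ 4 by rewrite exprn_even_ge0.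
  have [k Tk] : exists k : nat, T ^+ 4 = k%:R by exists `|T ^+ 4|%N; rewrite natz gez0_abs.
  move: HT; rewrite Tk -natrM !ler_nat.
  move: #|F| p2 => p p2 h; rewrite -(@leq_pmul2r (p ^ 3)%N) ?expn_gt0 ?(ltnW p2) //.
  have p1 : (p <= 2 * p.-1)%N by lia.
  apply: leq_trans (_ : 4 * (k * (p.-1 ^ 2 * p)) <= _)%N; last first.
    rewrite -[leqRHS]mulnA -expnD (_ : 108 = 4 * 27)%N // -mulnA leq_mul2l /=.
    exact: h.
  rewrite mulnCA leq_mul2l; apply/orP; right.
  by rewrite expnSr mulnA leq_mul2r; apply/orP; right; rewrite -(expnMn 2 _ 2) leq_exp2r.
(* The term removed at $0$ is absorbed by $(u+1)^4 \le 8(u^4+1)$; then $8(108 p^3 + 1) \le 1000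
   p^3$. *)
apply: le_trans (_ : 8%:R * (T ^+ 4 + 1) <= _).
  have q1 := qchar_norm f.[0].
  have [u [u0 Tu]] : exists u, 0 <= u /\ `|T| = u by exists `|T|.
  have -> : T ^+ 4 = u ^+ 4 by rewrite -Tu -normrX ger0_norm // exprn_even_ge0.
  apply: le_trans (_ : (u + 1) ^+ 4 <= _).
    rewrite -[leLHS]ger0_norm ?exprn_even_ge0 // normrX lerXn2r ?nnegrE ?addr_ge0 //.
    by apply: le_trans (ler_normB _ _) _; rewrite Tu lerD.
  rewrite -subr_ge0.
  have -> : 8%:R * (u ^+ 4 + 1) - (u + 1) ^+ 4 = (u - 1) ^+ 2 * (7%:R * u ^+ 2 + 10%:R * u + 7%:R)
    by ring.
  by rewrite mulr_ge0 ?exprn_even_ge0 // !addr_ge0 ?mulr_ge0 ?exprn_ge0.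
have p3 : (0 < #|F| ^ 3)%N by rewrite expn_gt0 (ltnW p2).
move: T4; rewrite !natz; move: (T ^+ 4) (#|F| ^ 3)%N p3 => x y; lia.
Qed.

Lemma sum_qchar_sqr2 (a b c : F) : b != c ->
  `|\sum_x qchar (x + a) ^+ 2 * (qchar (x + b) * qchar (x + c))| <= 2.
Proof.
move=> bc; have := norm_sum_qchar2 bc.
set S := \sum_x _; set S' := \sum_x _.
have -> : S' = S - qchar (- a + b) * qchar (- a + c).
  rewrite /S /S' (bigD1 (- a)) //= addNr qchar0 expr0n mul0r add0r.
  rewrite [in RHS](bigD1 (- a)) //= addrAC subrr add0r.
  apply: eq_bigr => x xa; rewrite qchar_sqr.
  by rewrite addr_eq0 xa mul1r.
have := mulr_ile1 (normr_ge0 _) (normr_ge0 _) (qchar_norm (- a + b)) (qchar_norm (- a + c)).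
rewrite -normrM; move: (_ * _) => u; lia.
Qed.

(** If two shifts coincide, their square drops out up to one term and a two-factor sum with distinct
    shifts is left, bounded by 2. Otherwise all four are distinct and [sum_qchar4] applies. *)
Lemma sum_qchar4_unpaired (a b c d : F) : ~~ paired a b c d ->
  (\sum_x qchar (x + a) * qchar (x + b) * qchar (x + c) * qchar (x + d)) ^+ 4
    <= (1000 * #|F| ^ 3)%:R.
Proof.
have triv (S : int) : `|S| <= 2 -> S ^+ 4 <= (1000 * #|F| ^ 3)%:R.
  move=> S2; apply: le_trans (_ : 2 ^+ 4 <= _).
    rewrite -[leLHS]ger0_norm ?exprn_even_ge0 // normrX.
    by rewrite lerXn2r // nnegrE.
  rewrite (_ : 2 ^+ 4 = 16%:R) // ler_nat; have : (0 < #|F| ^ 3)%N by rewrite expn_gt0 (ltnW (finNzRing_gt1 F)).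
  lia.
have red x y z t : z != t -> x = y -> \sum_u qchar (u + a) * qchar (u + b) * qchar (u + c) * qchar (u + d)
    = \sum_u qchar (u + x) * qchar (u + y) * (qchar (u + z) * qchar (u + t)) ->
   (\sum_u qchar (u + a) * qchar (u + b) * qchar (u + c) * qchar (u + d)) ^+ 4
    <= (1000 * #|F| ^ 3)%:R.
  by move=> zt <- ->; apply: triv; apply: sum_qchar_sqr2.
rewrite /paired !negb_or !negb_and.
have [ab|ab] /= := eqVneq a b.
  move=> /andP[cd _]; apply: (red a b c d) => //.
  by apply: eq_bigr => u _; ring.
have [cd|cd] /= := eqVneq c d.
  move=> _; apply: (red c d a b) => //.
  by apply: eq_bigr => u _; ring.
have [ac|ac] /= := eqVneq a c.
  move=> /andP[bd _]; apply: (red a c b d) => //.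
  by apply: eq_bigr => u _; ring.
have [bd|bd] /= := eqVneq b d.
  move=> _; apply: (red b d a c) => //.
  by apply: eq_bigr => u _; ring.
have [ad|ad] /= := eqVneq a d.
  move=> bc; apply: (red a d b c) => //.
  by apply: eq_bigr => u _; ring.
have [bc|bc] /= := eqVneq b c.
  move=> _; apply: (red b c a d) => //.
  by apply: eq_bigr => u _; ring.
by move=> _; apply: sum_qchar4; rewrite /= !inE !negb_or ab ac ad bc bd cd.
Qed.
End QuadraticCharacter.

(** * The Jacobi character *)

Section JacobiCharacter.

Variable N : nat.
Let n := N.+2.
Hypothesis odd_n : odd n.
Hypothesis sqf_n : forall p, prime p -> ~~ (p * p %| n)%N.

Definition redp (p : nat) (x : 'I_N.+2) : 'F_p := (x : nat)%:R.

Lemma redpD p x y : p \in primes n -> redp p (x + y) = redp p x + redp p y.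
Proof.
rewrite mem_primes => /and3P[pp _ pn]; rewrite /redp -natrD.
by rewrite -[RHS](Fp_nat_mod pp) -[LHS](Fp_nat_mod pp) /= modn_dvdm.
Qed.

Lemma redpM p x y : p \in primes n -> redp p (x * y) = redp p x * redp p y.
Proof.
rewrite mem_primes => /and3P[pp _ pn]; rewrite /redp -natrM.
by rewrite -[RHS](Fp_nat_mod pp) -[LHS](Fp_nat_mod pp) /= modn_dvdm.
Qed.

Lemma redp_nat p k : p \in primes n -> redp p k%:R = k%:R.
Proof.
rewrite mem_primes => /and3P[pp _ pn]; rewrite /redp.
have -> : k%:R = inZp k :> 'I_N.+2 by exact: Zp_nat.
transitivity ((k %% n)%:R : 'F_p); first by [].
by rewrite -(Fp_nat_mod pp k) -(Fp_nat_mod pp (k %% n)) modn_dvdm.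
Qed.

Lemma odd_card_Fp p : p \in primes n -> odd #|'F_p|.
Proof.
rewrite mem_primes => /and3P[pp _ pn]; rewrite card_Fp //.
by apply: dvdn_odd odd_n.
Qed.

(** Square-freeness makes the cofactor a unit modulo [p], so its multiples reach every residue class
    modulo [p]. *)
Lemma redp_cofactor p : p \in primes n -> redp p (n %/ p)%:R != 0.
Proof.
move=> pP; rewrite redp_nat //; move: pP; rewrite mem_primes => /and3P[pp _ pn].
rewrite -(dvdn_pcharf (pchar_Fp pp)); apply: contra (sqf_n pp) => pq.
by rewrite -[X in (_ %| X)%N](divnK pn) dvdn_mul.
Qed.

Lemma redp_cofactor_neq p r : p \in primes n -> r \in primes n -> r != p ->
  redp r (n %/ p)%:R = 0.
Proof.
move=> pP rP rp; rewrite redp_nat //; apply/eqP.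
move: pP rP; rewrite !mem_primes => /and3P[pp _ pn] /and3P[rr _ rn].
rewrite -(dvdn_pcharf (pchar_Fp rr)).
move: rn; rewrite -[X in (_ %| X)%N](divnK pn) Euclid_dvdM // => /orP[] //.
by rewrite dvdn_prime2 // (negPf rp).
Qed.

(* A form of the Chinese remainder theorem: translating by multiples of [n %/ p] fixes [h]
   and runs through all residues modulo [p]. *)
Lemma sum_redp (R : comPzRingType) p (h : 'I_N.+2 -> R) (K : 'F_p -> R) :
  p \in primes n -> (forall x, h (x + (n %/ p)%:R) = h x) ->
  (\sum_x h x * K (redp p x)) *+ p = (\sum_x h x) * (\sum_z K z).
Proof.
move=> pP hq; have := pP; rewrite mem_primes => /and3P[pp _ pn].
have hqi i x : h (x + (n %/ p)%:R *+ i) = h x.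
  by elim: i => [|i IH]; rewrite ?mulr0n ?addr0 // mulrSr addrA hq IH.
transitivity (\sum_(z : 'F_p) \sum_x h x * K (redp p x)).
  by rewrite sumr_const card_Fp.
transitivity (\sum_(z : 'F_p) \sum_x h x * K (redp p x + redp p (n %/ p)%:R * z)).
  apply: eq_bigr => z _; rewrite (reindex_inj (addIr ((n %/ p)%:R *+ (z : nat)))) /=.
  apply: eq_bigr => x _; rewrite hqi; congr (_ * K _).
  by rewrite redpD // -mulr_natr redpM // [redp p z%:R]redp_nat // natr_Zp.
rewrite exchange_big mulr_suml; apply: eq_bigr => x _; rewrite -mulr_sumr; congr (_ * _).
rewrite [RHS](reindex (fun z => redp p x + redp p (n %/ p)%:R * z)) //.
have q0 := redp_cofactor pP.
by apply: onW_bij; exists (fun y => (y - redp p x) / redp p (n %/ p)%:R) => z; field.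
Qed.

(** Each prime is taken once; for square-free [n] this is the Jacobi symbol, as [jacobi_jchar]
    shows. *)
Definition jchar (x : 'I_N.+2) : int := \prod_(p <- primes n) qchar (redp p x).

Lemma jcharM x y : jchar (x * y) = jchar x * jchar y.
Proof.
rewrite /jchar -big_split /= !big_seq; apply: eq_bigr => p pP.
by rewrite redpM // qcharM // odd_card_Fp.
Qed.

Lemma jchar_norm x : `|jchar x| <= 1.
Proof.
rewrite /jchar normr_prod; apply: prodr_ile1 => p _.
by rewrite normr_ge0 qchar_norm.
Qed.

Lemma redp_eq0 p x : p \in primes n -> (redp p x == 0) = (p %| x)%N.
Proof.
by rewrite mem_primes => /and3P[pp _ _]; rewrite (dvdn_pcharf (pchar_Fp pp)).
Qed.

Lemma jchar_eq0P x :
  reflect (exists2 p, p \in primes n & redp p x = 0) (jchar x == 0).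
Proof.
rewrite /jchar prodf_seq_eq0 /=; apply: (iffP hasP) => -[p pP].
  by rewrite qchar_eq0 => /eqP; exists p.
by move=> r0; exists p => //; rewrite qchar_eq0 r0.
Qed.

Lemma jchar_eq0 x : (jchar x == 0) = ~~ coprime x n.
Proof.
apply/jchar_eq0P/idP => [[p pP /eqP]|].
  rewrite redp_eq0 // => px; move: pP; rewrite mem_primes => /and3P[pp _ pn].
  apply/negP => /eqP g1.
  by have := dvdn_gcd p x n; rewrite px pn g1 dvdn1 => /eqP p1; rewrite p1 in pp.
rewrite /coprime => g1.
have g2 : (1 < gcdn x n)%N.
  have : (0 < gcdn x n)%N by rewrite gcdn_gt0 orbT.
  by move: g1; case: (gcdn x n) => // -[].
have := pdiv_dvd (gcdn x n); rewrite dvdn_gcd => /andP[px pn].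
have pP : pdiv (gcdn x n) \in primes n by rewrite mem_primes pdiv_prime.
by exists (pdiv (gcdn x n)) => //; apply/eqP; rewrite redp_eq0.
Qed.

Lemma jchar_sqr x : jchar x ^+ 2 = (jchar x != 0)%:R.
Proof.
have [->|j0] /= := eqVneq (jchar x) 0; first by rewrite expr0n.
move: (jchar_norm x) j0; move: (jchar x) => y; case: y => [[|[|k]]|[|k]] //=; lia.
Qed.

(** The part of the character away from [p]; its invariance under translation by [n %/ p] lets it
    serve as [h] in [sum_redp]. *)
Definition jchar' p (x : 'I_N.+2) : int := \prod_(r <- rem p (primes n)) qchar (redp r x).

Lemma jchar_split p x : p \in primes n -> jchar x = qchar (redp p x) * jchar' p x.
Proof. by move=> pP; rewrite /jchar (big_rem p pP). Qed.

Lemma jchar'_norm p x : `|jchar' p x| <= 1.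
Proof.
rewrite /jchar' normr_prod; apply: prodr_ile1 => r _.
by rewrite normr_ge0 qchar_norm.
Qed.

Lemma jchar'_shift p x : p \in primes n -> jchar' p (x + (n %/ p)%:R) = jchar' p x.
Proof.
move=> pP; rewrite /jchar' !big_seq; apply: eq_bigr => r.
rewrite mem_rem_uniq ?primes_uniq // => /andP[/= rp rP].
by rewrite redpD // (redp_cofactor_neq pP rP rp) addr0.
Qed.

(** Union bound over the primes of [n]: each one accounts for [n / p] zeros, and [p] is at least
    [pdiv n]. *)
Lemma card_jchar_eq0 :
  (#|[pred x | jchar x == 0%R]| * pdiv n <= size (primes n) * n)%N.
Proof.
have cardp p : p \in primes n -> (#|[pred x | redp p x == 0%R]| * p = n)%N.
  move=> pP; have := sum_redp (R := int) (h := fun=> 1) (fun z => (z == 0)%:R) pP (fun=> erefl).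
  have -> : \sum_(z : 'F_p) (z == 0)%:R = 1 :> int.
    by rewrite (bigD1 0) // eqxx big1 ?addr0 // => z /negPf ->.
  rewrite sumr_const card_ord mulr1; under eq_bigr do rewrite mul1r.
  rewrite -natr_sum -[_ *+ p]mulr_natr -natrM => /eqP.
  rewrite eqr_nat => /eqP; apply: etrans; congr (_ * _)%N.
  by rewrite -sum1_card big_mkcond; apply: eq_bigr => x _; rewrite inE; case: eqP.
have le p : p \in primes n -> (#|[pred x | redp p x == 0%R]| * pdiv n <= n)%N.
  move=> pP; rewrite -[leqRHS](cardp p pP) leq_mul2l pdiv_min_dvd ?orbT //.
    by move: pP; rewrite mem_primes => /and3P[/prime_gt1].
  by move: pP; rewrite mem_primes => /and3P[].
apply: leq_trans (_ : (\sum_(p <- primes n) #|[pred x | redp p x == 0%R]|) * pdiv n <= _)%N.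
  rewrite leq_mul2r; apply/orP; right.
  rewrite -sum1_card big_mkcond /=.
  under [leqRHS]eq_bigr do rewrite -sum1_card big_mkcond /=.
  rewrite exchange_big /=; apply: leq_sum => x _.
  case: ifP => //; rewrite inE => /jchar_eq0P[p pP /eqP r0].
  by rewrite (big_rem p pP) /= inE r0.
rewrite big_distrl /= big_seq; apply: leq_trans (leq_sum _ le) _.
by rewrite -big_seq big_const_seq count_predT iter_addn_0 mulnC.
Qed.

(** [sum_redp] splits off the local factor at [p]; the sum over the remaining factors is bounded
    trivially by [n]. *)
Lemma jchar_sum4 p (a b c d : 'I_N.+2) : p \in primes n ->
  `|\sum_x jchar (x + a) * jchar (x + b) * jchar (x + c) * jchar (x + d)| * p%:R <=
  n%:R * `|\sum_(z : 'F_p) qchar (z + redp p a) * qchar (z + redp p b) *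
      qchar (z + redp p c) * qchar (z + redp p d)|.
Proof.
move=> pP; pose h x := jchar' p (x + a) * jchar' p (x + b) * jchar' p (x + c) * jchar' p (x + d).
pose K (z : 'F_p) := qchar (z + redp p a) * qchar (z + redp p b) *
      qchar (z + redp p c) * qchar (z + redp p d).
have hq x : h (x + (n %/ p)%:R) = h x.
  by rewrite /h ![x + (n %/ p)%:R + _]addrAC !jchar'_shift.
have := sum_redp K pP hq.
rewrite (eq_bigr (fun x => jchar (x + a) * jchar (x + b) * jchar (x + c) * jchar (x + d))); last first.
  by move=> x _; rewrite /h /K !(jchar_split _ pP) !redpD //; ring.
move/(congr1 (fun t : int => `|t|)); rewrite normrMn -[X in X = _]mulr_natr normrM => ->.
apply: ler_wpM2r => //; apply: le_trans (ler_norm_sum _ _ _) _.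
rewrite -[X in _ <= X%:R]card_ord -sumr_const; apply: ler_sum => x _.
by rewrite /h !normrM !mulr_ile1 ?mulr_ge0 ?normr_ge0 ?jchar'_norm.
Qed.

(** Distinct shifts below [L] stay distinct modulo the least prime, whose local sum alone saves a
    factor $p^{1/4}$. Fourth powers keep the inequality within the integers. *)
Lemma sum_jchar4_unpaired L (a b c d : nat) : (L <= pdiv n)%N ->
  (a < L)%N -> (b < L)%N -> (c < L)%N -> (d < L)%N -> ~~ paired a b c d ->
  (\sum_x jchar (x + a%:R) * jchar (x + b%:R) * jchar (x + c%:R) * jchar (x + d%:R)) ^+ 4
   * (pdiv n)%:R <= 1000%:R * n%:R ^+ 4.
Proof.
set p := pdiv n => Lp aL bL cL dL npr.
have pp : prime p by rewrite pdiv_prime.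
have pP : p \in primes n by rewrite mem_primes pp pdiv_dvd.
have inj i j : (i < L)%N -> (j < L)%N -> (redp p i%:R == redp p j%:R) = (i == j).
  move=> iL jL; rewrite !redp_nat //.
  apply/eqP/eqP => [/(congr1 (fun x : 'F_p => (x : nat)))|-> //].
  by rewrite /= !val_Fp_nat // !modn_small // (leq_trans _ Lp).
have npr' : ~~ paired (redp p a%:R) (redp p b%:R) (redp p c%:R) (redp p d%:R).
  by rewrite /paired !inj.
have := sum_qchar4_unpaired (odd_card_Fp pP) npr'.
have := jchar_sum4 a%:R b%:R c%:R d%:R pP.
set S := \sum_x _; set T := \sum_z _ => h1 h2.
have p0 : 0 < p%:R ^+ 3 :> int by rewrite exprn_gt0 // ltr0n prime_gt0.
rewrite -(ler_pM2r p0) -mulrA -exprS.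
have h3 : (`|S| * p%:R) ^+ 4 <= (n%:R * `|T|) ^+ 4.
  by rewrite lerXn2r // nnegrE mulr_ge0.
rewrite exprMn -normrX ger0_norm ?exprn_even_ge0 // in h3.
apply: le_trans h3 _.
rewrite exprMn -normrX (ger0_norm (exprn_even_ge0 _ _)) //.
have -> : 1000%:R * n%:R ^+ 4 * p%:R ^+ 3 = n%:R ^+ 4 * (1000%:R * p%:R ^+ 3) :> int by ring.
apply: ler_wpM2l; first exact: exprn_ge0.
by apply: le_trans h2 _; rewrite card_Fp // natrM natrX.
Qed.

(** The product is 1 unless one of its four factors vanishes, which is counted once per factor. *)
Lemma sum_jchar4_paired (a b c d : 'I_N.+2) : paired a b c d ->
  `|\sum_x jchar (x + a) * jchar (x + b) * jchar (x + c) * jchar (x + d) - n%:R| <=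
  4%:R * #|[pred x | jchar x == 0]|%:R.
Proof.
move=> pr; have cardE (e : 'I_N.+2) :
    \sum_x (jchar (x + e) == 0)%:R = #|[pred x | jchar x == 0]|%:R :> int.
  rewrite -sum1_card natr_sum [RHS]big_mkcond /= [RHS](reindex_inj (addIr e)) /=.
  by apply: eq_bigr => x _; rewrite inE; case: eqP.
have -> : n%:R = \sum_(x : 'I_N.+2) 1 :> int by rewrite sumr_const card_ord.
rewrite -sumrB; apply: le_trans (ler_norm_sum _ _ _) _.
have -> : 4%:R * #|[pred x | jchar x == 0]|%:R = \sum_x ((jchar (x + a) == 0)%:R +
  (jchar (x + b) == 0)%:R + (jchar (x + c) == 0)%:R + (jchar (x + d) == 0)%:R) :> int.
  by rewrite !big_split /= !cardE; ring.
apply: ler_sum => x _.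
have [->|a0] := eqVneq (jchar (x + a)) 0.
  by rewrite !mul0r sub0r normrN1 -!natrD ler1n; lia.
have [->|b0] := eqVneq (jchar (x + b)) 0.
  by rewrite mulr0 !mul0r sub0r normrN1 -!natrD ler1n; lia.
have [->|c0] := eqVneq (jchar (x + c)) 0.
  by rewrite mulr0 !mul0r sub0r normrN1 -!natrD ler1n; lia.
have [->|d0] := eqVneq (jchar (x + d)) 0.
  by rewrite mulr0 sub0r normrN1 -!natrD ler1n; lia.
suff -> : jchar (x + a) * jchar (x + b) * jchar (x + c) * jchar (x + d) = 1 by rewrite subrr.
have sq u v : jchar u != 0 -> jchar v != 0 -> jchar u ^+ 2 * jchar v ^+ 2 = 1.
  by move=> u0 v0; rewrite !jchar_sqr u0 v0.
case/or3P: pr => /andP[/eqP <- /eqP <-].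
- by rewrite -(sq _ _ a0 c0); ring.
- by rewrite -(sq _ _ a0 b0); ring.
- by rewrite -(sq _ _ a0 b0); ring.
Qed.

Lemma mulI_coprime (k : 'I_N.+2) : coprime k n -> injective (fun x : 'I_N.+2 => x * k).
Proof.
move=> ck x y /= /eqP; rewrite -subr_eq0 -mulrBl => /eqP/(congr1 val) /= /eqP.
rewrite -/(dvdn n _) Gauss_dvdl 1?coprime_sym // => dv.
apply/eqP; rewrite -subr_eq0; apply/eqP/val_inj => /=.
have := ltn_ord (x - y).
by move: dv => /dvdnP[[|q] /= ->] //; rewrite mulSn ltnNge leq_addr.
Qed.

(** For [k] coprime to [n] this is the substitution of [x * k] for [x]. If a prime [p] divides both,
    [x * k] is unchanged by translating [x] by [n %/ p], so [sum_redp] produces the factor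
    [sum_qchar], which is zero. *)
Lemma jchar_dft (R : numDomainType) (psi : 'I_N.+2 -> R) k :
  \sum_x (jchar x)%:~R * psi (x * k) = (jchar k)%:~R * \sum_x (jchar x)%:~R * psi x.
Proof.
have [|j0] := eqVneq (jchar k) 0.
  move=> k0; rewrite k0 mul0r.
  have /jchar_eq0P [p pP rk] := introT eqP k0.
  have qk : (n %/ p)%:R * k = 0.
    move/eqP: rk; rewrite redp_eq0 // => /dvdnP[m km].
    have pn : (p %| n)%N by move: pP; rewrite mem_primes => /and3P[].
    have -> : k = (m * p)%:R by rewrite -km; apply/esym; exact: natr_Zp.
    rewrite -natrM mulnCA divnK // natrM.
    rewrite (_ : n%:R = 0) ?mulr0 //.
    by have -> : n%:R = inZp n :> 'I_N.+2 by [exact: Zp_nat]; apply/val_inj; rewrite /= modnn.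
  pose h x : R := (jchar' p x)%:~R * psi (x * k).
  have hq x : h (x + (n %/ p)%:R) = h x.
    by rewrite /h jchar'_shift // mulrDl qk addr0.
  have := sum_redp (fun z => (qchar z)%:~R) pP hq.
  rewrite -(rmorph_sum (@intmul R 1)) sum_qchar ?odd_card_Fp // mulr0.
  rewrite (eq_bigr (fun x => (jchar x)%:~R * psi (x * k))); last first.
    by move=> x _; rewrite /h (jchar_split _ pP) intrM mulrC mulrA.
  move/eqP; rewrite mulrn_eq0 => /orP[|/eqP //].
  by move: pP; rewrite mem_primes => /and3P[/prime_gt0]; case: (p).
have ck : coprime k n by rewrite -[coprime _ _]negbK -jchar_eq0.
rewrite [X in _ = _ * X](reindex_inj (mulI_coprime ck)) mulr_sumr.
apply: eq_bigr => x _; rewrite jcharM intrM mulrA [_ * (_ * _)]mulrCA -intrM.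
by rewrite -expr2 jchar_sqr j0 mulr1.
Qed.
End JacobiCharacter.

(** * Finite Fourier analysis *)

Local Open Scope complex_scope.

Section SquaredModulus.

Variable R : rcfType.
Implicit Types (x y : R[i]) (a : R).

Definition sqnorm x : R := normc x ^+ 2.

Lemma normc_ge0 x : 0 <= normc x.
Proof. by case: x => a b; rewrite /normc sqrtr_ge0. Qed.

Lemma sqnormE x : sqnorm x = complex.Re x ^+ 2 + complex.Im x ^+ 2.
Proof. by case: x => a b; rewrite /sqnorm /normc sqr_sqrtr // addr_ge0 ?sqr_ge0. Qed.

Lemma sqnorm_conj x : (sqnorm x)%:C = x * conjc x.
Proof.
rewrite sqnormE; case: x => a b /=; apply/eqP; rewrite eq_complex /=.
by apply/andP; split; apply/eqP; ring.
Qed.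

Lemma sqnorm_ge0 x : 0 <= sqnorm x.
Proof. exact: sqr_ge0. Qed.

Lemma sqnormM x y : sqnorm (x * y) = sqnorm x * sqnorm y.
Proof. by rewrite /sqnorm normcM exprMn. Qed.

Lemma sqnormX x k : sqnorm (x ^+ k) = sqnorm x ^+ k.
Proof.
elim: k => [|k IH]; last by rewrite !exprS sqnormM IH.
by rewrite /sqnorm !expr0 normc1 expr1n.
Qed.

Lemma sqnormR a : sqnorm a%:C = a ^+ 2.
Proof. by rewrite sqnormE /= expr0n addr0. Qed.

Lemma normcR a : normc a%:C = `|a|.
Proof. by rewrite /normc /= expr0n addr0 sqrtr_sqr. Qed.

Lemma normcJ x : normc (conjc x) = normc x.
Proof. by case: x => a b; rewrite /normc /= sqrrN. Qed.

Lemma conjcM x y : conjc (x * y) = conjc x * conjc y.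
Proof. exact: rmorphM. Qed.

Lemma conjc_sum (I : Type) (r : seq I) (P : pred I) (F : I -> R[i]) :
  conjc (\sum_(i <- r | P i) F i) = \sum_(i <- r | P i) conjc (F i).
Proof. exact: rmorph_sum. Qed.

Lemma normc_sum (I : Type) (r : seq I) (P : pred I) (F : I -> R[i]) :
  normc (\sum_(i <- r | P i) F i) <= \sum_(i <- r | P i) normc (F i).
Proof.
elim/big_rec2: _ => [|i y1 y2 _ le]; first by rewrite normc0.
by apply: le_trans (le_normcD _ _) _; rewrite lerD2l.
Qed.

Lemma sqnormD_le x y : sqnorm (x + y) <= 2 * (sqnorm x + sqnorm y).
Proof.
rewrite !sqnormE; case: x y => [a b] [c d] /=.
have := sqr_ge0 (a - c); have := sqr_ge0 (b - d); nra.
Qed.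

(** Tangent-line inequality for $t^4$, followed by $2D \le k + D^2/k$: the distance is traded for
    its square, whose sum over all frequencies Parseval's identity evaluates. *)
Lemma sqnorm_sqr_lower x y K k : normc y <= K -> 0 < k ->
  sqnorm y ^+ 2 - 2 * K ^+ 3 * (k + sqnorm (x - y) / k) <= sqnorm x ^+ 2.
Proof.
move=> yK k0; rewrite /sqnorm.
have tri : normc y <= normc x + normc (x - y).
  by rewrite -[X in normc X <= _](subKr x) (le_trans (le_normcD _ _)) // normcN.
have := normc_ge0 x; have := normc_ge0 y; have := normc_ge0 (x - y).
move: (normc x) (normc y) (normc (x - y)) tri yK => X Y D tri yK D0 Y0 X0.
have amgm : 2 * D <= k + D ^+ 2 / k.
  have -> : k + D ^+ 2 / k = 2 * D + (k - D) ^+ 2 / k.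
    by field; rewrite gt_eqF.
  by rewrite lerDl divr_ge0 ?sqr_ge0 // ltW.
have K0 : 0 <= K ^+ 3 by rewrite exprn_ge0 // (le_trans Y0).
have h1 : 2 * K ^+ 3 * (2 * D) <= 2 * K ^+ 3 * (k + D ^+ 2 / k).
  by rewrite ler_wpM2l // mulr_ge0.
have h2 : Y ^+ 3 * D <= K ^+ 3 * D by rewrite ler_wpM2r // lerXn2r ?nnegrE // (le_trans Y0).
have h3 : Y ^+ 3 * (Y - X) <= Y ^+ 3 * D.
  by rewrite ler_wpM2l ?exprn_ge0 //; lra.
have h4 : Y ^+ 4 - 4 * (Y ^+ 3 * (Y - X)) <= X ^+ 4.
  rewrite -subr_ge0.
  have -> : X ^+ 4 - (Y ^+ 4 - 4 * (Y ^+ 3 * (Y - X)))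
     = (X - Y) ^+ 2 * (X ^+ 2 + 2 * X * Y + 3 * Y ^+ 2) by ring.
  by rewrite mulr_ge0 ?sqr_ge0 // !addr_ge0 ?mulr_ge0 ?sqr_ge0.
rewrite -!exprM /=; lra.
Qed.

End SquaredModulus.


Local Arguments conjc {R} x : simpl never.

Section FiniteFourier.

Variables (R : rcfType) (N : nat) (w : R[i]).
Let n := N.+2.
Hypothesis w1 : sqnorm w = 1.
Hypothesis wn : w ^+ n = -1.
Hypothesis prim : n.-primitive_root (w ^+ 2).

Implicit Types (x y k l m : 'I_N.+2).

Definition psi x : R[i] := (w ^+ 2) ^+ x.

Lemma psiD x y : psi (x + y) = psi x * psi y.
Proof. by rewrite /psi -exprD /= (prim_expr_mod prim). Qed.

Lemma psi0 : psi 0 = 1.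
Proof. by rewrite /psi expr0. Qed.

Lemma psiM x y : psi (x * y) = psi y ^+ x.
Proof. by rewrite /psi /= (prim_expr_mod prim) mulnC exprM. Qed.

Lemma sqnorm_psi x : sqnorm (psi x) = 1.
Proof. by rewrite /psi !sqnormX w1 !expr1n. Qed.

Lemma psiNr x : psi x * psi (- x) = 1.
Proof. by rewrite -psiD subrr psi0. Qed.

Lemma psi_conj x : conjc (psi x) = psi (- x).
Proof.
by rewrite -[LHS]mul1r -(psiNr x) mulrAC -sqnorm_conj sqnorm_psi mul1r.
Qed.

Lemma sum_psi k : \sum_x psi (x * k) = if k == 0 then n%:R else 0.
Proof.
case: eqVneq => [->|k0].
  under eq_bigr do rewrite mulr0 psi0.
  by rewrite sumr_const card_ord.
set S := \sum_x _.
have: psi k * S = S.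
  rewrite /S mulr_sumr [RHS](reindex_inj (addIr 1)); apply: eq_bigr => x _.
  by rewrite mulrDl mul1r psiD mulrC.
move/eqP; rewrite -subr_eq0 -[X in _ - X]mul1r -mulrBl mulf_eq0 subr_eq0 => /orP[|/eqP //].
rewrite /psi -(prim_order_dvd prim) => /dvdnP[[|q] kq].
  by case/eqP: k0; apply/val_inj.
by have := ltn_ord k; rewrite kq mulSn ltnNge leq_addr.
Qed.

Definition dft (f : 'I_N.+2 -> R[i]) l : R[i] := \sum_x f x * psi (x * l).

Lemma parseval f : \sum_l sqnorm (dft f l) = n%:R * \sum_x sqnorm (f x).
Proof.
apply: (@complexI R); rewrite rmorphM !rmorph_sum rmorph_nat /=.
under eq_bigr do rewrite sqnorm_conj /dft conjc_sum mulr_sum2.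
rewrite exchange_big mulr_sumr; apply: eq_bigr => x _.
rewrite exchange_big /= (bigD1 x) //= [X in _ + X]big1 ?addr0 => [|y yx].
  under eq_bigr do rewrite conjcM psi_conj mulrACA psiNr mulr1 -sqnorm_conj.
  by rewrite sumr_const card_ord mulr_natl.
under eq_bigr do rewrite conjcM psi_conj mulrACA -psiD -mulrBl [(x - y) * _]mulrC.
by rewrite -mulr_sumr sum_psi subr_eq0 eq_sym (negPf yx) mulr0.
Qed.

Definition halfu x : R[i] := w ^+ x.

(** Coefficients expanding $w^x$ in the $n$ characters [psi], as in [halfu_fcoef]; they express
    values at odd $2n$-th roots of unity through values at even ones. *)
Definition fcoef m : R[i] := n%:R^-1 * dft halfu (- m).

Lemma n_neq0 : n%:R != 0 :> R[i].
Proof. by rewrite pnatr_eq0. Qed.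

Lemma sqnorm_halfu x : sqnorm (halfu x) = 1.
Proof. by rewrite /halfu sqnormX w1 expr1n. Qed.

Lemma halfu_fcoef x : halfu x = \sum_m fcoef m * psi (x * m).
Proof.
under eq_bigr do rewrite /fcoef /dft -mulrA mulr_suml.
rewrite -mulr_sumr exchange_big /= (bigD1 x) //= [X in _ + X]big1 ?addr0 => [|y yx].
  under eq_bigr do rewrite -mulrA -psiD mulrN addNr psi0 mulr1.
  by rewrite sumr_const card_ord -[halfu x *+ _]mulr_natl mulKf ?n_neq0.
under eq_bigr do rewrite -mulrA -psiD mulrN addrC -mulrBl [(x - y) * _]mulrC.
by rewrite -mulr_sumr sum_psi subr_eq0 eq_sym (negPf yx) mulr0.
Qed.

Lemma sqnorm_natV : sqnorm (n%:R^-1 : R[i]) = n%:R ^- 2.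
Proof.
by rewrite /sqnorm normcV -[n%:R](rmorph_nat (real_complex R)) normcR ger0_norm // exprVn.
Qed.

Lemma sum_sqnorm_fcoef : \sum_m sqnorm (fcoef m) = 1.
Proof.
rewrite (reindex_inj oppr_inj) /=.
under eq_bigr do rewrite /fcoef opprK sqnormM sqnorm_natV.
rewrite -mulr_sumr parseval; under eq_bigr do rewrite sqnorm_halfu.
by rewrite sumr_const card_ord -/n; field; rewrite pnatr_eq0.
Qed.

(** Geometric series whose ratio has [n]-th power -1. *)
Lemma fcoef_closed m : fcoef m * (1 - w * psi (- m)) = 2 / n%:R.
Proof.
rewrite /fcoef /dft -mulrA.
rewrite (eq_bigr (fun x : 'I_N.+2 => (w * psi (- m)) ^+ x)); last first.
  by move=> x _; rewrite psiM exprMn.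
set z := w * psi (- m).
have zn : z ^+ n = -1.
  by rewrite exprMn wn /psi (exprAC _ _ n) (prim_expr_order prim) expr1n mulr1.
have := subrX1 z n; rewrite zn => h.
have -> : (\sum_(i < N.+2) z ^+ i) * (1 - z) = 2 by rewrite mulrC -opprB mulNr -h; ring.
by rewrite mulrC.
Qed.

(** Since $w^n = -1$, [halfu] is additive-to-multiplicative only up to the carry modulo [n].
    Counting these signs gives all the main terms at the odd points beyond the $\ell^2$ mass. *)
Definition wrap_sign x y : R[i] := if (x + y < n)%N then 1 else -1.

Lemma halfuM x y : halfu x * halfu y = wrap_sign x y * halfu (x + y).
Proof.
rewrite /halfu /wrap_sign -exprD /=; case: ltnP => h.
  by rewrite modn_small // mul1r.
have {1}-> : (x + y = (x + y - n) + n)%N by rewrite subnK.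
have lt : (x + y - n < n)%N by have := ltn_ord x; have := ltn_ord y; rewrite -/n; lia.
have -> : ((x + y) %% n = x + y - n)%N.
  by rewrite -{1}(subnK h) modnDr modn_small.
by rewrite exprD wn mulrC.
Qed.

Lemma sum_sign (a : nat) : (a <= n)%N ->
  \sum_(x < n) (if (x < a)%N then 1 else -1) = 2 * a%:R - n%:R :> R[i].
Proof.
move=> an; transitivity (\sum_(x < n) (2 * (x < a)%N%:R - 1) : R[i]).
  by apply: eq_bigr => x _; case: (x < a)%N => /=; ring.
rewrite big_split /= -mulr_sumr sumr_const card_ord mulNrn; congr (2 * _ - _).
rewrite -natr_sum; congr (_%:R).
rewrite -(big_mkord xpredT (fun i => (i < a)%N : nat)) (big_cat_nat (leq0n a) an) /=.
rewrite [X in (_ + X)%N]big_nat_cond [X in (_ + X)%N]big1 ?addn0; last first.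
  by move=> i /andP[/andP[ai _] _]; rewrite ltnNge ai.
rewrite big_nat_cond (eq_bigr (fun=> 1%N)); last by move=> i /andP[/andP[_ ->]].
by rewrite -big_nat_cond sum_nat_const_nat subn0 muln1.
Qed.

Lemma sum_wrap_sign y : \sum_x wrap_sign x y = n%:R - 2 * (y : nat)%:R.
Proof.
transitivity (\sum_(x < n) (if (x < n - y)%N then 1 else -1) : R[i]).
  by apply: eq_bigr => x _; rewrite /wrap_sign ltn_subRL addnC.
by rewrite sum_sign ?leq_subr // natrB ?(ltnW (ltn_ord y)) //; ring.
Qed.

(** Adding [x] and [t - x] carries exactly when [x] exceeds [t], so [t + 1] of the [n] signs are
    positive. *)
Lemma sum_halfu_conv t : \sum_x halfu x * halfu (t - x) =
  halfu t * (2 * (t : nat)%:R + 2 - n%:R).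
Proof.
under eq_bigr do rewrite halfuM addrCA subrr addr0 mulrC.
rewrite -mulr_sumr; congr (_ * _).
transitivity (\sum_(x < n) (if (x < t.+1)%N then 1 else -1) : R[i]).
  apply: eq_bigr => x _; rewrite /wrap_sign ltnS /=; congr (if _ then _ else _).
  have := ltn_ord x; have := ltn_ord t; rewrite modnDmr -/n.
  move: (x : nat) (t : nat) => a b bn an; case: (leqP a b) => ab.
    have -> : (b + (n - a) = (b - a) + n)%N by lia.
    by rewrite modnDr modn_small; lia.
  by rewrite modn_small; lia.
by rewrite sum_sign // -natr1; ring.
Qed.

(** Products of Fourier coefficients correspond to convolutions: up to $1/n$ the twisted sum of
    squares is the self-convolution of [halfu] at $-2s$. This is the only place where the main term
    sees the rotation. *)
Lemma sum_fcoef_sqr (s : 'I_N.+2) :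
  normc (\sum_m (fcoef m * psi (- (s * m))) ^+ 2) =
  `|2 * ((- (s + s) : 'I_N.+2) : nat)%:R + 2 - n%:R| / n%:R.
Proof.
pose t : 'I_N.+2 := - (s + s).
have -> : \sum_m (fcoef m * psi (- (s * m))) ^+ 2 =
   n%:R^-1 * (halfu t * (2 * (t : nat)%:R + 2 - n%:R)).
  transitivity (n%:R^-1 * n%:R^-1 * \sum_m \sum_x \sum_y halfu x * halfu y * psi (m * (t - x - y))).
    rewrite mulr_sumr; apply: eq_bigr => m _.
    have -> : (fcoef m * psi (- (s * m))) ^+ 2 = n%:R^-1 * n%:R^-1 *
        (dft halfu (- m) * dft halfu (- m) * psi (- (s * m) + - (s * m))).
      by rewrite psiD /fcoef; move: (n%:R^-1) => v; ring.
    congr (_ * _).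
    rewrite /dft mulr_sum2 mulr_suml; apply: eq_bigr => x _.
    rewrite mulr_suml; apply: eq_bigr => y _.
    transitivity (halfu x * halfu y * (psi (x * - m) * psi (y * - m) *
      psi (- (s * m) + - (s * m)))); first by ring.
    by rewrite -!psiD; congr (_ * psi _); rewrite /t; ring.
  rewrite -mulrA; congr (_ * _).
  rewrite exchange_big /=; under eq_bigr do rewrite exchange_big /=.
  under eq_bigr do under eq_bigr do rewrite -mulr_sumr sum_psi.
  rewrite -sum_halfu_conv mulr_sumr; apply: eq_bigr => x _.
  rewrite (bigD1 (t - x)) //= subrr eqxx [X in _ + X]big1 ?addr0 => [|y yx].
    by rewrite [halfu x * _ * _]mulrC mulKf ?n_neq0.
  by rewrite subr_eq0 eq_sym (negPf yx) mulr0.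
rewrite !normcM normcV.
have nE (j : nat) : j%:R = (j%:R)%:C :> R[i] by rewrite rmorph_nat.
have -> : normc (halfu t) = 1.
  by apply/eqP; rewrite -(eqrXn2 (n := 2)) ?normc_ge0 // expr1n -[_ ^+ 2]/(sqnorm _) sqnorm_halfu.
have -> : 2 * (t : nat)%:R + 2 - n%:R = (2 * (t : nat)%:R + 2 - n%:R)%:C :> R[i].
  by rewrite rmorphB rmorphD rmorphM !rmorph_nat.
by rewrite (nE n) !normcR mul1r normr_nat mulrC.
Qed.

Lemma sum_sqr_arith (k : nat) (a : R) : 3 * \sum_(x < k) (a - 2 * (x : nat)%:R) ^+ 2 =
  k%:R * (3 * a ^+ 2 - 6 * a * (k%:R - 1) + 2 * (k%:R - 1) * (2 * k%:R - 1)).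
Proof.
elim: k => [|k IH]; first by rewrite big_ord0 mulr0 mul0r.
by rewrite big_ord_recr /= mulrDr IH -natr1; ring.
Qed.

(** The squared moduli of the coefficients form the transform of the autocorrelation of [halfu],
    which [sum_wrap_sign] evaluates as [halfu d] times $n - 2d$. Parseval then leaves a sum of
    squares in arithmetic progression. *)
Lemma sum_sqnorm_fcoef_sqr :
  \sum_m sqnorm (fcoef m) ^+ 2 = 1 / 3 + 2 / (3 * n%:R ^+ 2).
Proof.
have E m : (sqnorm (fcoef m))%:C =
    n%:R ^- 2 * dft (fun d => halfu d * (n%:R - 2 * (d : nat)%:R)) (- m).
  rewrite sqnorm_conj /fcoef conjcM conjc_inv conjc_nat mulrACA -expr2 exprVn; congr (_ * _).
  rewrite /dft conjc_sum mulr_sum2 exchange_big /=.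
  transitivity (\sum_y \sum_d wrap_sign y d * halfu d * psi (d * - m)).
    apply: eq_bigr => y _; rewrite (reindex_inj (addrI y)) /=; apply: eq_bigr => d _.
    have -> : halfu (y + d) = wrap_sign y d * (halfu y * halfu d).
      by rewrite halfuM mulrA /wrap_sign; case: ifP => _; ring.
    rewrite conjcM psi_conj mulrACA -psiD; congr (_ * psi _); last by ring.
    rewrite -mulrA; congr (_ * _); rewrite mulrAC.
    by rewrite -sqnorm_conj sqnorm_halfu mul1r.
  rewrite exchange_big; apply: eq_bigr => d _; rewrite -!mulr_suml sum_wrap_sign.
  by rewrite [halfu d * _]mulrC.
have E2 m : sqnorm (fcoef m) ^+ 2 = n%:R ^- 4 *
    sqnorm (dft (fun d => halfu d * (n%:R - 2 * (d : nat)%:R)) (- m)).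
  rewrite -sqnormR E sqnormM -exprVn sqnormX sqnorm_natV.
  by rewrite (exprVn _ 2) -exprM.
rewrite (eq_bigr _ (fun m _ => E2 m)) -mulr_sumr (reindex_inj oppr_inj) /=.
under eq_bigr do rewrite opprK.
rewrite parseval.
under eq_bigr do rewrite sqnormM sqnorm_halfu mul1r.
rewrite (eq_bigr (fun d : 'I_n => (n%:R - 2 * (d : nat)%:R) ^+ 2 : R)); last first.
  by move=> d _; rewrite -sqnormR rmorphB rmorphM !rmorph_nat.
have := sum_sqr_arith n n%:R; set S := \sum_(_ < _) _ => h.
have n0 : n%:R != 0 :> R by rewrite pnatr_eq0.
have -> : S = n%:R * (n%:R ^+ 2 + 2) / 3.
  apply: (mulfI (x := 3)); first by rewrite pnatr_eq0.
  by rewrite h; field.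
by field.
Qed.

End FiniteFourier.

(** * The lower bound for the fourth moment *)

Section FourthMoment.

Variables (R : rcfType) (N : nat).
Let n := N.+2.

(** Two different pairings hold together only if all four entries agree, and then all three do:
    hence the correction by 2. *)
Lemma natr_paired (A : comPzRingType) (T : eqType) (a b c d : T) :
  (paired a b c d)%:R = (a == b)%:R * (c == d)%:R + (a == c)%:R * (b == d)%:R
    + (a == d)%:R * (b == c)%:R - 2 * ((a == b)%:R * (a == c)%:R * (a == d)%:R) :> A.
Proof.
rewrite /paired.
have [ab|ab] := eqVneq a b; have [ac|ac] := eqVneq a c; have [ad|ad] := eqVneq a d;
  rewrite -?ab -?ac -?ad ?eqxx ?(negPf ab) ?(negPf ac) ?(negPf ad) /=.
all: rewrite ?eqxx ?[b == a]eq_sym ?[c == a]eq_sym ?[d == a]eq_sym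
  ?(negPf ab) ?(negPf ac) ?(negPf ad) /= ?andbF ?andbT ?orbF; try ring.
all: try by case: (_ == _) => /=; ring.
Qed.

Lemma sum_delta (A : pzRingType) (T : finType) (a : T) (F : T -> A) :
  \sum_x (a == x)%:R * F x = F a.
Proof.
rewrite (bigD1 a) //= eqxx mul1r big1 ?addr0 // => x.
by rewrite eq_sym => /negPf ->; rewrite mul0r.
Qed.

(** Two of the pairings match each entry with a conjugate and give the squared $\ell^2$ mass. The
    pairing [x = z], [y = t] matches like with like and gives the squared modulus of the sum of
    squares. *)
Lemma sum_paired (T : finType) (b : T -> R[i]) :
  \sum_x \sum_y \sum_z \sum_t
     b x * conjc (b y) * b z * conjc (b t) * (paired x y z t)%:R =
  (2 * (\sum_x sqnorm (b x)) ^+ 2 + sqnorm (\sum_x b x ^+ 2)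
    - 2 * \sum_x sqnorm (b x) ^+ 2)%:C.
Proof.
under eq_bigr do under eq_bigr do under eq_bigr do under eq_bigr do
  rewrite natr_paired mulrBr !mulrDr.
have -> : (2 * (\sum_x sqnorm (b x)) ^+ 2 + sqnorm (\sum_x b x ^+ 2)
    - 2 * \sum_x sqnorm (b x) ^+ 2)%:C =
  (\sum_x sqnorm (b x))%:C ^+ 2 + (sqnorm (\sum_x b x ^+ 2))%:C + (\sum_x sqnorm (b x))%:C ^+ 2
   - (2 * \sum_x sqnorm (b x) ^+ 2)%:C.
  by rewrite rmorphB rmorphD !rmorphM rmorph_nat; ring.
under eq_bigr do under eq_bigr do under eq_bigr do rewrite sumrB !big_split /=.
under eq_bigr do under eq_bigr do rewrite sumrB !big_split /=.
under eq_bigr do rewrite sumrB !big_split /=.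
rewrite sumrB !big_split /=; congr (_ + _ + _ - _).
- rewrite expr2 rmorph_sum mulr_sum2 /=; apply: eq_bigr => x _.
  transitivity (\sum_y (x == y)%:R * (b x * conjc (b y) * \sum_z (sqnorm (b z))%:C)).
    apply: eq_bigr => y _; rewrite !mulr_sumr; apply: eq_bigr => z _.
    transitivity (\sum_t (z == t)%:R * ((x == y)%:R * (b x * conjc (b y) * b z * conjc (b t)))).
      by apply: eq_bigr => t _; ring.
    by rewrite sum_delta sqnorm_conj; ring.
  by rewrite sum_delta -sqnorm_conj mulr_sumr.
- rewrite sqnorm_conj conjc_sum mulr_sum2; apply: eq_bigr => x _; apply: eq_bigr => y _.
  transitivity (\sum_z (x == z)%:R * (b x * conjc (b y) * b z * conjc (b y))).
    apply: eq_bigr => z _.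
    transitivity (\sum_t (y == t)%:R * ((x == z)%:R * (b x * conjc (b y) * b z * conjc (b t)))).
      by apply: eq_bigr => t _; ring.
    by rewrite sum_delta.
  by rewrite sum_delta !expr2 conjcM; ring.
- rewrite expr2 rmorph_sum mulr_sum2 /=; apply: eq_bigr => x _; apply: eq_bigr => y _.
  transitivity (\sum_z (y == z)%:R * (b x * conjc (b y) * b z * conjc (b x))).
    apply: eq_bigr => z _.
    transitivity (\sum_t (x == t)%:R * ((y == z)%:R * (b x * conjc (b y) * b z * conjc (b t)))).
      by apply: eq_bigr => t _; ring.
    by rewrite sum_delta.
  by rewrite sum_delta !sqnorm_conj; ring.
rewrite rmorphM rmorph_nat rmorph_sum mulr_sumr /=; apply: eq_bigr => x _.
transitivity (\sum_y (x == y)%:R * (2 * (b x * conjc (b y) * b x * conjc (b x)))); last first.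
  by rewrite sum_delta rmorphXn /= sqnorm_conj; ring.
apply: eq_bigr => y _.
transitivity (\sum_z (x == z)%:R * ((x == y)%:R * (2 * (b x * conjc (b y) * b z * conjc (b x))))); last first.
  by rewrite sum_delta.
apply: eq_bigr => z _.
transitivity (\sum_t (x == t)%:R * ((x == z)%:R * ((x == y)%:R * (2 * (b x * conjc (b y) * b z * conjc (b t)))))); last first.
  by rewrite sum_delta.
by apply: eq_bigr => t _; ring.
Qed.

(** Expanding the fourth power and summing over [l] first leaves complete sums of four translates.
    As [b] lives on [W], their estimate is required only for shifts in [W], and the total error is
    weighted by the $\ell^1$ norm of [b]. *)
Lemma fourth_moment (chi : 'I_N.+2 -> R) (b : 'I_N.+2 -> R[i]) (W : {pred 'I_N.+2}) (E : R) :
  (forall m, m \notin W -> b m = 0) ->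
  (forall x y z t, x \in W -> y \in W -> z \in W -> t \in W ->
    `|\sum_l chi (l + x) * chi (l + y) * chi (l + z) * chi (l + t) -
       n%:R * (paired x y z t)%:R| <= E) ->
  n%:R * (2 * (\sum_x sqnorm (b x)) ^+ 2 + sqnorm (\sum_x b x ^+ 2)
    - 2 * \sum_x sqnorm (b x) ^+ 2) - E * (\sum_x normc (b x)) ^+ 4 <=
  \sum_l sqnorm (\sum_m b m * (chi (l + m))%:C) ^+ 2.
Proof.
move=> bW HE.
pose S x y z t := \sum_l chi (l + x) * chi (l + y) * chi (l + z) * chi (l + t).
set L := (X in _ <= X); set M := (X in n%:R * X - _).
have LE : L%:C = \sum_x \sum_y \sum_z \sum_t
     b x * conjc (b y) * b z * conjc (b t) * (S x y z t)%:C.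
  rewrite /L rmorph_sum /=.
  transitivity (\sum_l \sum_x \sum_y \sum_z \sum_t b x * conjc (b y) * b z * conjc (b t) *
      (chi (l + x) * chi (l + y) * chi (l + z) * chi (l + t))%:C).
    apply: eq_bigr => l _; rewrite rmorphXn /= sqnorm_conj conjc_sum expr2 mulrA mulr_sum4.
    do 4!(apply: eq_bigr => ? _).
    by rewrite !conjcM !conjc_real !rmorphM /=; ring.
  rewrite exchange_big; apply: eq_bigr => x _; rewrite exchange_big; apply: eq_bigr => y _.
  rewrite exchange_big; apply: eq_bigr => z _; rewrite exchange_big; apply: eq_bigr => t _.
  by rewrite -mulr_sumr rmorph_sum.
have ME : (n%:R * M)%:C = \sum_x \sum_y \sum_z \sum_t
     b x * conjc (b y) * b z * conjc (b t) * (n%:R * (paired x y z t)%:R)%:C.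
  rewrite rmorphM /= /M -sum_paired mulr_sumr; apply: eq_bigr => x _.
  rewrite mulr_sumr; apply: eq_bigr => y _; rewrite mulr_sumr; apply: eq_bigr => z _.
  rewrite mulr_sumr; apply: eq_bigr => t _; rewrite rmorphM /= [X in _ = _ * (_ * X)]rmorph_nat.
  by move: ((n%:R)%:C) => ?; ring.
have DE : (L - n%:R * M)%:C = \sum_x \sum_y \sum_z \sum_t
     b x * conjc (b y) * b z * conjc (b t) * (S x y z t - n%:R * (paired x y z t)%:R)%:C.
  rewrite rmorphB /= LE ME -sumrB; apply: eq_bigr => x _; rewrite -sumrB; apply: eq_bigr => y _.
  rewrite -sumrB; apply: eq_bigr => z _; rewrite -sumrB; apply: eq_bigr => t _.
  by rewrite rmorphB mulrBr.
have : normc (L - n%:R * M)%:C <= E * (\sum_x normc (b x)) ^+ 4.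
  rewrite DE.
  have -> : E * (\sum_x normc (b x)) ^+ 4 =
      \sum_x \sum_y \sum_z \sum_t normc (b x) * normc (b y) * normc (b z) * normc (b t) * E.
    have pow4 (u : R) : u ^+ 4 = u * u * u * u by ring.
    rewrite mulrC pow4 mulr_sum4.
    rewrite mulr_suml; apply: eq_bigr => x _; rewrite mulr_suml; apply: eq_bigr => y _.
    by rewrite mulr_suml; apply: eq_bigr => z _; rewrite mulr_suml.
  apply: le_trans (normc_sum _ _ _) _; apply: ler_sum => x _.
  apply: le_trans (normc_sum _ _ _) _; apply: ler_sum => y _.
  apply: le_trans (normc_sum _ _ _) _; apply: ler_sum => z _.
  apply: le_trans (normc_sum _ _ _) _; apply: ler_sum => t _.
  rewrite !normcM !normcJ normcR.
  have [xW|/bW ->] := boolP (x \in W); last by rewrite normc0 !mul0r.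
  have [yW|/bW ->] := boolP (y \in W); last by rewrite normc0 mulr0 !mul0r.
  have [zW|/bW ->] := boolP (z \in W); last by rewrite normc0 mulr0 !mul0r.
  have [tW|/bW ->] := boolP (t \in W); last by rewrite normc0 mulr0 !mul0r.
  by apply: ler_wpM2l; [rewrite !mulr_ge0 ?normc_ge0 | exact: HE].
rewrite normcR ler_norml => /andP[h _]; lra.
Qed.
End FourthMoment.

(** * Lower bounds at the even and at the odd 2n-th roots of unity *)

Section LowerBound.

Variables (R : rcfType) (N : nat) (w : R[i]).
Let n := N.+2.
Hypothesis w1 : sqnorm w = 1.
Hypothesis wn : w ^+ n = -1.
Hypothesis prim : n.-primitive_root (w ^+ 2).

Variables (chi : 'I_N.+2 -> R) (G : R[i]).
Hypothesis chi_sqr : forall x, chi x ^+ 2 = (chi x != 0)%:R.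
Hypothesis chi_dft : forall k : 'I_N.+2, \sum_x (chi x)%:C * psi w (x * k) = (chi k)%:C * G.
Hypothesis sqnormG : sqnorm G = n%:R.

Variables (s : 'I_N.+2) (v : 'I_N.+2 -> R).
Hypothesis v_sqr : forall x, v x ^+ 2 = (chi (x + s) == 0)%:R.

Variables (W : {pred 'I_N.+2}) (E : R).
Hypothesis sum4W : forall x y z t, x \in W -> y \in W -> z \in W -> t \in W ->
    `|\sum_l chi (l + x) * chi (l + y) * chi (l + z) * chi (l + t) -
       n%:R * (paired x y z t)%:R| <= E.

Local Notation c := (fcoef (N := N) w).
Local Notation u := (halfu (N := N) w).
Local Notation z := (\sum_x (chi x == 0)%:R : R).
Local Notation tau := (\sum_(m | m \notin W) sqnorm (c m)).
Local Notation M := (\sum_(m in W) normc (c m)).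

Let cW (m : 'I_N.+2) : R[i] := if m \in W then c m else 0.
(** Truncated coefficient together with the phase that the rotation by [s] puts on [J (l + m)]; see
    [PE]. *)
Let b m := cW m * psi w (- (s * m)).
Let J l := dft w (fun x => (chi (x + s))%:C) l.
Let P (l : 'I_N.+2) := \sum_m cW m * J (l + m).

Lemma dft_shift l : J l = psi w (- (s * l)) * ((chi l)%:C * G).
Proof.
rewrite /J /dft (reindex_inj (addIr (- s))) /= -chi_dft mulr_sumr.
apply: eq_bigr => x _; rewrite subrK mulrCA; congr (_ * _).
by rewrite -psiD // ; congr psi; ring.
Qed.

Lemma chi_sqr_le1 x : chi x ^+ 2 <= 1.
Proof. by rewrite chi_sqr; case: (_ != _). Qed.

Lemma normc_chi x : normc (chi x)%:C <= 1.
Proof.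
rewrite normcR -(@ler_pXn2r _ 2) ?nnegrE ?normr_ge0 // expr1n -normrX.
by rewrite ger0_norm ?sqr_ge0 ?chi_sqr_le1.
Qed.

Lemma normc_psi (x : 'I_N.+2) : normc (psi w x) = 1.
Proof.
apply/eqP; rewrite -(eqrXn2 (n := 2)) ?normc_ge0 // expr1n -[_ ^+ 2]/(sqnorm _).
by rewrite sqnorm_psi.
Qed.

Lemma normc_J l : normc (J l) <= normc G.
Proof.
by rewrite dft_shift !normcM normc_psi mul1r ler_piMl ?normc_ge0 ?normc_chi.
Qed.

Lemma sqnorm_J l : sqnorm (J l) = n%:R * chi l ^+ 2.
Proof. by rewrite dft_shift !sqnormM sqnorm_psi // mul1r sqnormR sqnormG mulrC. Qed.

Lemma sum_v_sqr : \sum_x v x ^+ 2 = z.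
Proof.
under eq_bigr do rewrite v_sqr.
by rewrite [RHS](reindex_inj (addIr s)).
Qed.

Lemma tau_ge0 : 0 <= tau.
Proof. by apply: sumr_ge0 => x _; exact: sqnorm_ge0. Qed.

Lemma normcG_gt0 : 0 < normc G.
Proof.
rewrite lt_neqAle normc_ge0 andbT eq_sym; apply/eqP => g0.
by have := sqnormG; rewrite /sqnorm g0 expr0n => /eqP; rewrite eq_sym pnatr_eq0.
Qed.

Lemma dftB f g l : dft w f l - dft w g l = dft w (fun x : 'I_N.+2 => f x - g x) l.
Proof. by rewrite /dft -sumrB; apply: eq_bigr => x _; rewrite mulrBl. Qed.

Lemma even_part eta : 0 < eta ->
  n%:R ^+ 2 * (n%:R - z) - 2 * n%:R ^+ 3 * eta - 2 * n%:R ^+ 2 * z / eta <=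
  \sum_l sqnorm (dft w (fun x => (chi (x + s) + v x)%:C) l) ^+ 2.
Proof.
move=> e0; pose g := normc G; have g0 : 0 < g := normcG_gt0.
have g2 : g ^+ 2 = n%:R := sqnormG.
(* With the slack a multiple of [g], only even powers of [g] survive, and [g ^+ 2] is [n]. *)
have k0 : 0 < g * eta by rewrite mulr_gt0.
pose D l := dft w (fun x => (v x)%:C) l.
apply: le_trans (_ : \sum_l (sqnorm (J l) ^+ 2 -
    2 * g ^+ 3 * (g * eta + sqnorm (D l) / (g * eta))) <= _); last first.
  apply: ler_sum => l _.
  have -> : D l = dft w (fun x => (chi (x + s) + v x)%:C) l - J l.
    rewrite /D dftB; apply: eq_bigr => x _; congr (_ * _).
    by rewrite -rmorphB addrAC subrr add0r.
  exact: sqnorm_sqr_lower (normc_J l) k0.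
rewrite sumrB -mulr_sumr big_split /= sumr_const card_ord -mulr_suml parseval //.
under [X in _ <= _ - _ * (_ + _ * X / _)]eq_bigr do rewrite sqnormR.
rewrite sum_v_sqr.
have -> : \sum_l sqnorm (J l) ^+ 2 = n%:R ^+ 2 * (n%:R - z).
  rewrite -[X in _ * (X - _)](_ : \sum_(l : 'I_n) 1 = _); last by rewrite sumr_const card_ord.
  rewrite -sumrB mulr_sumr; apply: eq_bigr => l _.
  rewrite sqnorm_J exprMn chi_sqr; congr (_ * _).
  by case: eqP => _ /=; ring.
have -> : 2 * g ^+ 3 * (g * eta *+ N.+2 + n%:R * z / (g * eta)) =
   2 * g ^+ 2 * g ^+ 2 * n%:R * eta + 2 * g ^+ 2 * n%:R * z / eta.
  by rewrite -mulr_natr -/n; field; rewrite !gt_eqF.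
rewrite g2 le_eqVlt; apply/orP; left; apply/eqP; field.
by rewrite gt_eqF.
Qed.

Lemma PE l : P l = G * psi w (- (s * l)) * \sum_m b m * (chi (l + m))%:C.
Proof.
rewrite /P mulr_sumr; apply: eq_bigr => m _; rewrite dft_shift /b mulrDr opprD psiD //.
ring.
Qed.

Lemma normc_b m : normc (b m) = normc (cW m).
Proof. by rewrite /b normcM normc_psi mulr1. Qed.

Lemma sqnorm_b m : sqnorm (b m) = sqnorm (cW m).
Proof. by rewrite /sqnorm normc_b. Qed.

Lemma sum_normc_b : \sum_m normc (b m) = M.
Proof.
rewrite [RHS]big_mkcond; apply: eq_bigr => m _; rewrite normc_b /cW.
by case: ifP => // _; rewrite normc0.
Qed.

Lemma normc_P l : normc (P l) <= normc G * M.
Proof.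
rewrite PE !normcM normc_psi mulr1 ler_wpM2l ?normc_ge0 // -sum_normc_b.
apply: le_trans (normc_sum _ _ _) _; apply: ler_sum => m _.
by rewrite normcM ler_piMr ?normc_ge0 ?normc_chi.
Qed.

Lemma sum_sqnorm_b : \sum_m sqnorm (b m) = 1 - tau.
Proof.
rewrite -(sum_sqnorm_fcoef w1 prim) [in RHS](bigID (mem W)) /= addrK.
rewrite [RHS]big_mkcond; apply: eq_bigr => m _; rewrite sqnorm_b /cW.
by case: ifP => // _; rewrite /sqnorm normc0 expr0n.
Qed.

Local Notation y := (`|2 * ((- (s + s) : 'I_N.+2) : nat)%:R + 2 - n%:R| / n%:R : R).

(** Truncation moves the twisted sum by at most [tau]; since [y <= 1], squaring at most doubles this
    loss. *)
Lemma sum_b_sqr : y ^+ 2 - 2 * tau <= sqnorm (\sum_m b m ^+ 2).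
Proof.
have y0 : 0 <= y by rewrite divr_ge0.
have y1 : y <= 1.
  rewrite ler_pdivrMr ?ltr0n // mul1r ler_norml.
  have := ltn_ord (- (s + s)); rewrite -/n -(@ler_nat R) -natr1.
  have := ler0n R (- (s + s)); lra.
have t0 := tau_ge0.
have h : y <= normc (\sum_m b m ^+ 2) + tau.
  rewrite -(sum_fcoef_sqr w1 wn prim s).
  have -> : \sum_m (c m * psi w (- (s * m))) ^+ 2 = \sum_m b m ^+ 2 +
      \sum_(m | m \notin W) (c m * psi w (- (s * m))) ^+ 2.
    rewrite (bigID (mem W)) /=; congr (_ + _); rewrite big_mkcond.
    apply: eq_bigr => m _; rewrite /b /cW; case: ifP => // _.
    by rewrite mul0r expr0n.
  apply: le_trans (le_normcD _ _) _; rewrite lerD2l.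
  apply: le_trans (normc_sum _ _ _) _; apply: ler_sum => m _.
  by rewrite /sqnorm !expr2 !normcM normc_psi !mulr1.
rewrite /sqnorm; have := normc_ge0 (\sum_m b m ^+ 2).
move: (normc _) h y0 y1 t0 => Y; move: y tau => yy tt h y0 y1 t0 Y0.
have [|lt] := leP tt yy => [le|]; last by nra.
have : (yy - tt) ^+ 2 <= Y ^+ 2 by rewrite lerXn2r ?nnegrE //; lra.
nra.
Qed.

Lemma sum_sqnorm_b_sqr : \sum_m sqnorm (b m) ^+ 2 <= 1 / 3 + 2 / (3 * n%:R ^+ 2).
Proof.
rewrite -(sum_sqnorm_fcoef_sqr w1 wn prim); apply: ler_sum => m _.
rewrite sqnorm_b /cW; case: ifP => // _.
by rewrite /sqnorm normc0 !expr0n /= sqr_ge0.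
Qed.

(** The constants come from $2(1-\tau)^2 \ge 2 - 4\tau$, from $y^2 - 2\tau$, and from subtracting
    $2(1/3 + 2/(3n^2))$. *)
Lemma sum_sqnorm_P : n%:R ^+ 2 * (n%:R * (4 / 3 + y ^+ 2 - 6 * tau - 4 / (3 * n%:R ^+ 2))
    - E * M ^+ 4) <= \sum_l sqnorm (P l) ^+ 2.
Proof.
have bW m : m \notin W -> b m = 0 by rewrite /b /cW => /negPf ->; rewrite mul0r.
have := fourth_moment bW sum4W.
rewrite sum_normc_b sum_sqnorm_b => h.
apply: le_trans (_ : n%:R ^+ 2 * \sum_l sqnorm (\sum_m b m * (chi (l + m))%:C) ^+ 2 <= _); last first.
  rewrite mulr_sumr; apply: ler_sum => l _.
  by rewrite PE !sqnormM sqnorm_psi // mulr1 sqnormG [leRHS]exprMn.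
rewrite ler_wpM2l ?sqr_ge0 //; apply: le_trans h.
rewrite lerD2r ler_wpM2l ?ler0n //.
have h1 := sum_b_sqr; have h2 := sum_sqnorm_b_sqr.
have -> : 4 / (3 * n%:R ^+ 2) = 2 * (2 / (3 * n%:R ^+ 2)) :> R by field; rewrite pnatr_eq0.
move: (2 / _) h2 => r h2; have := sqr_ge0 tau; move: tau h1 => t h1; nra.
Qed.

Lemma odd_part eta : 0 < eta ->
  n%:R ^+ 2 * (n%:R * (4 / 3 + y ^+ 2 - 6 * tau - 4 / (3 * n%:R ^+ 2)) - E * M ^+ 4)
  - 2 * M ^+ 3 * (n%:R ^+ 3 * eta + 2 * n%:R ^+ 2 * (n%:R * tau + z) / eta) <=
  \sum_l sqnorm (dft w (fun x => (chi (x + s) + v x)%:C * u x) l) ^+ 2.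
Proof.
move=> e0; pose g := normc G; have g0 : 0 < g := normcG_gt0.
have g2 : g ^+ 2 = n%:R := sqnormG.
have k0 : 0 < g * eta by rewrite mulr_gt0.
have M0 : 0 <= M by apply: sumr_ge0 => m _; exact: normc_ge0.
pose q x := \sum_m cW m * psi w (x * m).
have Pq l : P l = dft w (fun x => (chi (x + s))%:C * q x) l.
  rewrite /P /J /dft /q; under eq_bigr do rewrite mulr_sumr.
  rewrite exchange_big /=; apply: eq_bigr => x _; rewrite mulr_sumr mulr_suml.
  by apply: eq_bigr => m _; rewrite mulrDr psiD //; ring.
pose A l := dft w (fun x => (chi (x + s) + v x)%:C * u x) l.
pose d x := (chi (x + s))%:C * (u x - q x) + (v x)%:C * u x.
have AP l : A l - P l = dft w d l.
  rewrite Pq dftB; apply: eq_bigr => x _; congr (_ * _).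
  by rewrite /d rmorphD /=; ring.
(* [u - q] is the transform of the omitted coefficients, so Parseval gives its mass. *)
have uq : \sum_x sqnorm (u x - q x) = n%:R * tau.
  pose c' m := if m \in W then 0 else c m.
  rewrite (eq_bigr (fun x => sqnorm (dft w c' x))); last first.
    move=> x _; rewrite (halfu_fcoef prim) /q -sumrB; congr sqnorm; apply: eq_bigr => m _.
    by rewrite /c' /cW [m * x]mulrC; case: ifP => _; ring.
  rewrite parseval // [in RHS]big_mkcond; congr (_ * _); apply: eq_bigr => m _.
  by rewrite /c'; case: ifP => //= _; rewrite /sqnorm normc0 expr0n.
have sd : \sum_x sqnorm (d x) <= 2 * (n%:R * tau + z).
  rewrite -uq -sum_v_sqr -big_split /= mulr_sumr; apply: ler_sum => x _.
  apply: le_trans (sqnormD_le _ _) _; rewrite ler_wpM2l ?lerD //.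
    by rewrite sqnormM sqnormR ler_piMl ?sqnorm_ge0 ?chi_sqr_le1.
  by rewrite sqnormM sqnormR sqnorm_halfu // mulr1.
apply: le_trans (_ : \sum_l (sqnorm (P l) ^+ 2 -
    2 * (g * M) ^+ 3 * (g * eta + sqnorm (A l - P l) / (g * eta))) <= _); last first.
  by apply: ler_sum => l _; exact: sqnorm_sqr_lower (normc_P l) k0.
rewrite sumrB; apply: lerB; first exact: sum_sqnorm_P.
under eq_bigr do rewrite AP.
rewrite -mulr_sumr big_split /= sumr_const card_ord -mulr_suml parseval //.
apply: le_trans (_ : 2 * (g * M) ^+ 3 *
   (g * eta *+ N.+2 + n%:R * (2 * (n%:R * tau + z)) / (g * eta)) <= _).
  apply: ler_wpM2l; first by rewrite mulr_ge0 // exprn_ge0 // mulr_ge0 // ltW.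
  by rewrite lerD2l ler_wpM2r ?invr_ge0 ?(ltW k0) // ler_wpM2l ?ler0n.
have -> : 2 * (g * M) ^+ 3 * (g * eta *+ N.+2 + n%:R * (2 * (n%:R * tau + z)) / (g * eta)) =
   2 * M ^+ 3 * (g ^+ 2 * g ^+ 2 * n%:R * eta + 2 * g ^+ 2 * n%:R * (n%:R * tau + z) / eta).
  by rewrite -mulr_natr -/n; field; rewrite !gt_eqF.
rewrite g2 le_eqVlt; apply/orP; left; apply/eqP; field.
by rewrite gt_eqF.
Qed.

End LowerBound.

(** * Roots of unity and interpolation coefficients *)

Section RootsOfUnity.

Definition cis (t : R) : R[i] := Complex (cos t) (sin t).
Arguments cis t%_ring_scope.

Lemma cisD s t : cis (s + t) = cis s * cis t.
Proof.
apply/eqP; rewrite eq_complex /= -RplusE cos_plus sin_plus !RealsE.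
by apply/andP; split; apply/eqP; ring.
Qed.

Lemma cis0 : cis 0 = 1.
Proof. by rewrite /cis cos_0 sin_0. Qed.

Lemma cisX t (k : nat) : cis t ^+ k = cis (k%:R * t).
Proof.
elim: k => [|k IH]; first by rewrite mulr0n mul0r cis0.
by rewrite exprS IH -cisD; congr cis; rewrite -natr1; ring.
Qed.

Lemma sqnorm_cis t : sqnorm (cis t) = 1.
Proof.
rewrite sqnormE /=; transitivity (sin t * sin t + cos t * cos t); first by ring.
exact: sin2_cos2.
Qed.

Lemma conjc_cis t : conjc (cis t) = cis (- t).
Proof. by rewrite /cis /= -RoppE cos_neg sin_neg. Qed.

Lemma sqnorm_1Bcis t : sqnorm (1 - cis (2 * t)) = (2 * sin t) ^+ 2.
Proof.
have c2 : cos (2 * t)%R = 1 - 2 * sin t ^+ 2.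
  by transitivity (1 - 2 * sin t * sin t); [exact: cos_2a_sin | ring].
have := sqnorm_cis (2 * t); rewrite !sqnormE /= c2 => h.
transitivity (1 - 2 * (1 - 2 * sin t ^+ 2) + ((1 - 2 * sin t ^+ 2) ^+ 2 + sin (2 * t)%R ^+ 2)).
  by ring.
by rewrite h; ring.
Qed.

Variable N : nat.
Let n := N.+2.
Definition wroot : R[i] := cis (PI / n%:R).
Local Notation w := wroot.

Lemma nR_gt0 : 0 < n%:R :> R.
Proof. by rewrite ltr0n. Qed.

Lemma nR_neq0 : n%:R != 0 :> R.
Proof. by rewrite pnatr_eq0. Qed.

Lemma PI_gt0 : 0 < PI :> R.
Proof. by apply/RltP; exact: PI_RGT_0. Qed.

Lemma wroot_sqnorm : sqnorm w = 1.
Proof. exact: sqnorm_cis. Qed.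

Lemma wroot_n : w ^+ n = -1.
Proof.
rewrite /wroot cisX mulrCA divff ?nR_neq0 // mulr1 /cis cos_PI sin_PI.
by apply/eqP; rewrite eq_complex /= oppr0 !eqxx.
Qed.

Lemma sin_gt0_frac (k : R) : 0 < k -> k < n%:R -> 0 < sin (PI * k / n%:R)%R.
Proof.
move=> k0 kn; apply/RltP.
have /RltP h1 : 0 < PI * k / n%:R by exact: divr_gt0 (mulr_gt0 PI_gt0 k0) nR_gt0.
have /RltP h2 : PI * k / n%:R < PI.
  by rewrite ltr_pdivrMr ?nR_gt0 // ltr_pM2l ?PI_gt0.
exact: sin_gt_0 h1 h2.
Qed.

Lemma wroot_prim : n.-primitive_root (w ^+ 2).
Proof.
apply/andP; split=> //; apply/forallP => i; apply/eqP; rewrite unity_rootE -exprM.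
have [->|ne] := eqVneq i.+1 n.
  by rewrite mulnC exprM wroot_n sqrrN expr1n eqxx.
apply/negbTE/eqP; rewrite /wroot cisX => h.
have lt : (i.+1 < n)%N by rewrite ltn_neqAle ne ltn_ord.
have := sqnorm_1Bcis (PI * i.+1%:R / n%:R).
rewrite (_ : 2 * _ = (2 * i.+1)%N%:R * (PI / n%:R)) ?h; last by rewrite natrM; ring.
rewrite subrr sqnormE /= expr0n addr0 => /eqP.
rewrite eq_sym sqrf_eq0 mulf_eq0 pnatr_eq0 /= gt_eqF // sin_gt0_frac ?ltr0n //.
by rewrite ltr_nat.
Qed.

Lemma rsumE (k : nat) (f : nat -> R) : rsum k f = \sum_(i < k) f i.
Proof. by elim: k => [|k IH] /=; [rewrite big_ord0 | rewrite big_ord_recr /= -IH]. Qed.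

Lemma poly_sq_cis (k : nat) (a : nat -> R) t :
  poly_sq k a t = sqnorm (\sum_(j < k) (a j)%:C * cis (j%:R * t)).
Proof.
have -> : \sum_(j < k) (a j)%:C * cis (j%:R * t) = Complex (poly_re k a t) (poly_im k a t).
  rewrite /poly_re /poly_im !rsumE.
  elim: k => [|k IH]; first by rewrite !big_ord0.
  rewrite !big_ord_recr /= IH; apply/eqP; rewrite eq_complex /= !INRE.
  by apply/andP; split; apply/eqP; rewrite !RealsE; ring.
by rewrite sqnormE /= /poly_sq !RealsE.
Qed.

Lemma cis_psi (x l : 'I_N.+2) : cis ((x : nat)%:R * (PI * (2 * l)%N%:R / n%:R)) = psi w (x * l).
Proof.
rewrite psiM ?wroot_prim // /psi -!exprM /wroot cisX; congr cis.
by rewrite !natrM; ring.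
Qed.

Lemma poly_sq_even a (l : 'I_N.+2) :
  poly_sq n a (PI * INR (2 * l) / INR n) = sqnorm (dft w (fun x => (a x)%:C) l).
Proof.
rewrite poly_sq_cis /dft; congr sqnorm; apply: eq_bigr => x _; congr (_ * _).
by rewrite !RealsE cis_psi.
Qed.

Lemma poly_sq_odd a (l : 'I_N.+2) :
  poly_sq n a (PI * INR (2 * l).+1 / INR n) =
  sqnorm (dft w (fun x => (a x)%:C * halfu w x) l).
Proof.
rewrite poly_sq_cis /dft; congr sqnorm; apply: eq_bigr => x _; rewrite -mulrA; congr (_ * _).
rewrite -cis_psi /halfu /wroot cisX -cisD; congr cis.
by rewrite !RealsE -natr1; ring.
Qed.

Lemma rsum_double (k : nat) (f : nat -> R) :
  rsum (2 * k) f = \sum_(l < k) f (2 * l)%N + \sum_(l < k) f (2 * l).+1.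
Proof.
elim: k => [|k IH]; first by rewrite muln0 !big_ord0 addr0.
rewrite mulnS !big_ord_recr /= -/(rsum _ _) IH !RealsE; ring.
Qed.

(** Modulus of [fcoef_closed]: the chord $|1 - e^{2it}|$ has length $2|\sin t|$. *)
Lemma normc_fcoef_sin (m : 'I_N.+2) :
  normc (fcoef w m) * (n%:R * `|sin (PI * ((m : nat)%:R - 2^-1) / n%:R)%R|) = 1.
Proof.
have := congr1 (@sqnorm R) (fcoef_closed wroot_n wroot_prim m).
have -> : w * psi w (- m) = cis (2 * - (PI * ((m : nat)%:R - 2^-1) / n%:R)).
  rewrite -psi_conj ?wroot_sqnorm ?wroot_prim // /psi -exprM /wroot cisX conjc_cis -cisD.
  by congr cis; rewrite natrM; have := nR_neq0; move: (n%:R : R) => nn nn0; field.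
rewrite sqnormM sqnorm_1Bcis -RoppE sin_neg RoppE.
have -> : sqnorm (2 / (N.+2)%:R : R[i]) = 4 / n%:R ^+ 2.
  have -> : 2 / (N.+2)%:R = (2 / n%:R)%:C :> R[i] by rewrite fmorph_div !rmorph_nat.
  by rewrite sqnormR expr_div_n; congr (_ / _); ring.
rewrite /sqnorm; set S := sin _; have f0 := normc_ge0 (fcoef w m).
move: (normc _) f0 => f f0 h.
have h2 : (f * (n%:R * `|S|)) ^+ 2 = 1.
  rewrite !exprMn -normrX (ger0_norm (sqr_ge0 S)).
  have : 4 * (f ^+ 2 * S ^+ 2) = 4 / n%:R ^+ 2 by rewrite -h; ring.
  have := nR_neq0; move: (n%:R : R) => nn nn0 e4.
  have -> : f ^+ 2 * (nn ^+ 2 * S ^+ 2) = 4 * (f ^+ 2 * S ^+ 2) * nn ^+ 2 / 4 by field.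
  by rewrite e4; field.
apply/eqP; rewrite -(eqrXn2 (n := 2)) ?mulr_ge0 ?normr_ge0 ?ler0n //.
by rewrite h2 expr1n.
Qed.

Lemma sin_ge_third (x : R) : 0 <= x -> x <= PI / 2 -> x / 3 <= sin x.
Proof.
move=> x0 x1; have p4 : PI <= 4 :> R.
  by apply/RleP; rewrite -INRE INR_IZR_INZ; exact: PI_4.
have /RleP xP : x <= PI by have := PI_gt0; lra.
have /RleP x0' := x0.
have [+ _] := sin_bound x 0 x0' xP.
rewrite /sin_approx /sin_term /= => /RleP h; apply: le_trans h.
rewrite !RealsE /=.
(* With $x \le 2$ the cubic Taylor term is at most $2x/3$. *)
have x2 : x <= 2 by lra.
have -> : IZR (-1) = - 1 by exact: (opp_IZR 1).
set L := (X in _ <= X); have -> : L = x - x ^+ 3 / 6 by rewrite /L; field.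
have : x ^+ 2 <= 4 by nra.
nra.
Qed.

(** Here [d] stands for twice the distance from $m - 1/2$ to the nearest multiple of $n$.
    [sin_ge_third] gives $6/(\pi d)$, and $\pi \ge 3$. *)
Lemma normc_fcoef_le (m : 'I_N.+2) (d : R) : 1 <= d -> d <= n%:R ->
  `|sin (PI * ((m : nat)%:R - 2^-1) / n%:R)%R| = sin (PI * d / (2 * n%:R))%R ->
  normc (fcoef w m) <= 2 / d.
Proof.
move=> d1 dn sE; have := normc_fcoef_sin m; rewrite sE => h.
have n0 := nR_gt0; have p0 := PI_gt0.
have p3 : 3 <= PI :> R.
  have /RltP : Rlt (IZR 3 / IZR 2) (PI / IZR 2) := PI2_3_2.
  rewrite !RdivE => hh; have -> : 3 = IZR 3 by rewrite -INRE INR_IZR_INZ.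
  have e2 : IZR 2 = 2 by rewrite -INRE INR_IZR_INZ.
  by move: hh; rewrite e2 ltr_pM2r ?invr_gt0 ?ltr0n // => /ltW.
pose x := PI * d / (2 * n%:R).
have x0 : 0 <= x.
  by apply: divr_ge0; [apply: mulr_ge0; [exact: ltW | exact: le_trans d1] | rewrite mulr_ge0 // ltW].
have x1 : x <= PI / 2.
  by rewrite /x ler_pdivrMr ?mulr_gt0 // mulrA divfK ?pnatr_eq0 // ler_pM2l.
have s3 := sin_ge_third x0 x1; rewrite -/x in h.
have f0 := normc_ge0 (fcoef w m); move: (normc _) f0 h => f f0 h.
have d0 : 0 < d by exact: lt_le_trans d1.
rewrite ler_pdivlMr //.
have e : n%:R * (x / 3) = PI * d / 6 by rewrite /x; field; rewrite gt_eqF.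
have h1 : f * (n%:R * (x / 3)) <= 1.
  by rewrite -[leRHS]h ler_wpM2l // ler_wpM2l // ltW.
have h2 : f * d * 3 <= f * d * PI by rewrite ler_wpM2l // mulr_ge0 // ltW.
have h3 : f * d * PI = 6 * (f * (n%:R * (x / 3))) by rewrite e; field.
rewrite h3 in h2.
have h4 : f * d * 3 <= 6 by apply: le_trans h2 _; rewrite -[leRHS]mulr1 ler_pM2l.
by rewrite -(@ler_pM2r _ 3) //; apply: le_trans h4 _; rewrite -natrM.
Qed.

Lemma normc_fcoef_low (m : 'I_N.+2) : (0 < m)%N -> (2 * m <= n.+1)%N ->
  normc (fcoef w m) <= 2 / (2 * (m : nat)%:R - 1).
Proof.
move=> m0 mn; have n0 := nR_gt0.
have m1 : 1 <= (m : nat)%:R :> R by rewrite ler1n.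
have mn' : 2 * (m : nat)%:R <= n%:R + 1 :> R by rewrite -natrM natr1 ler_nat.
apply: normc_fcoef_le; [lra | lra |].
have -> : PI * (2 * (m : nat)%:R - 1) / (2 * n%:R) = PI * ((m : nat)%:R - 2^-1) / n%:R.
  by field; rewrite gt_eqF.
rewrite ger0_norm // ltW // sin_gt0_frac //; lra.
Qed.

Lemma normc_fcoef_high (m : 'I_N.+2) : (n < 2 * m)%N ->
  normc (fcoef w m) <= 2 / (2 * (n - m)%N%:R + 1).
Proof.
move=> mn; have n0 := nR_gt0.
have mn1 : (m : nat)%:R + 1 <= n%:R :> R by rewrite natr1 ler_nat ltn_ord.
have m1 : 1 <= (m : nat)%:R :> R by rewrite ler1n; lia.
have mn' : n%:R + 1 <= 2 * (m : nat)%:R :> R by rewrite -natrM natr1 ler_nat.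
rewrite natrB; last exact: ltnW.
apply: normc_fcoef_le; [lra | lra |].
have -> : sin (PI * (2 * (n%:R - (m : nat)%:R) + 1) / (2 * n%:R))%R =
   sin (PI * ((m : nat)%:R - 2^-1) / n%:R)%R.
  rewrite -[RHS]sin_PI_x; congr sin; rewrite RminusE.
  by field; rewrite gt_eqF.
rewrite ger0_norm // ltW // sin_gt0_frac //; lra.
Qed.

Definition window T (m : 'I_N.+2) := (m <= T)%N || (n - T <= m)%N.

(** Telescoping, since $(2m-1)^2 \ge 4m(m-1)$. *)
Lemma sum_inv_sqr (T k : nat) : (0 < T)%N ->
  \sum_(T.+1 <= m < T.+1 + k) 4 / (2 * m%:R - 1) ^+ 2 <= T%:R^-1 - (T + k)%:R^-1 :> R.
Proof.
move=> T0; elim: k => [|k IH]; first by rewrite addn0 big_geq // addn0 subrr.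
rewrite addnS big_nat_recr ?leq_addr //=.
have t0 : 1 <= (T + k)%:R :> R by rewrite ler1n addn_gt0 T0.
suff h : 4 / (2 * (T.+1 + k)%:R - 1) ^+ 2 <= (T + k)%:R^-1 - (T + k.+1)%:R^-1 :> R by lra.
have e1 : (T.+1 + k)%:R = (T + k)%:R + 1 :> R by rewrite addSn natr1.
have e2 : (T + k.+1)%:R = (T + k)%:R + 1 :> R by rewrite addnS natr1.
rewrite e1 e2; move: ((T + k)%:R : R) t0 => x x1.
have -> : x^-1 - (x + 1)^-1 = (x * (x + 1))^-1 by field; rewrite !gt_eqF //; lra.
rewrite ler_pdivrMr; last by apply: exprn_gt0; lra.
rewrite mulrC ler_pdivlMr; nra.
Qed.

Lemma sum_inv_sqr_le (T k : nat) : (0 < T)%N ->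
  \sum_(T.+1 <= m < k) 4 / (2 * m%:R - 1) ^+ 2 <= T%:R^-1 :> R.
Proof.
move=> T0; have [kT|Tk] := leqP k T.+1; first by rewrite big_geq // invr_ge0.
rewrite -(subnKC (ltnW Tk)); apply: le_trans (sum_inv_sqr _ T0) _.
by rewrite gerBl invr_ge0.
Qed.

Lemma val_opp (m : 'I_N.+2) : m != 0 -> (- m : 'I_N.+2) = (n - m)%N :> nat.
Proof.
move=> m0; have mp : (0 < m)%N by rewrite lt0n.
rewrite /= modn_small //; move: mp; move: (m : nat) => k; rewrite /n; lia.
Qed.

Lemma windowN T (m : 'I_N.+2) : window T (- m) = window T m.
Proof.
have [->|m0] := eqVneq m 0; first by rewrite oppr0.
rewrite /window val_opp //.
have := ltn_ord m; have : (0 < m)%N by rewrite lt0n.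
move: (m : nat) => k; rewrite -/n; lia.
Qed.

Lemma tail_le T : (0 < T)%N ->
  \sum_(m | m \notin [pred m | window T m]) sqnorm (fcoef w m) <= 2 / T%:R.
Proof.
move=> T0; pose g (k : nat) : R := 4 / (2 * k%:R - 1) ^+ 2.
(* Residues above $n/2$ are treated through their opposites. *)
pose gN (m : 'I_N.+2) := g (- m : 'I_N.+2).
have g0 k : 0 <= g k by rewrite divr_ge0 ?sqr_ge0.
apply: le_trans (_ : \sum_(m : 'I_N.+2 | ~~ window T m) (g m + gN m) <= _).
  rewrite (eq_bigl (fun m => ~~ window T m)); last by move=> m; rewrite inE.
  apply: ler_sum => m; rewrite /window negb_or -!ltnNge => /andP[Tm mT].
  have m0 : (0 < m)%N by apply: leq_ltn_trans Tm.
  have mne : m != 0 by rewrite -lt0n in m0 *.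
  have mm : 1 <= (m : nat)%:R :> R by rewrite ler1n.
  have [le|lt] := leqP (2 * m) n.
    apply: le_trans (_ : g m <= _); last by rewrite lerDl /gN.
    have := normc_fcoef_low m0 (leqW le); have := normc_ge0 (fcoef w m).
    rewrite /sqnorm /g; move: (normc _) => f f0 fle.
    have -> : 4 / (2 * (m : nat)%:R - 1) ^+ 2 = (2 / (2 * (m : nat)%:R - 1)) ^+ 2 :> R.
      by rewrite expr_div_n; congr (_ / _); ring.
    by rewrite lerXn2r ?nnegrE // divr_ge0 //; lra.
  apply: le_trans (_ : gN m <= _); last by rewrite lerDr.
  have := normc_fcoef_high lt; have := normc_ge0 (fcoef w m).
  rewrite /sqnorm /gN /g val_opp //; move: (normc _) => f f0 fle.
  have nm : 1 <= (n - m)%N%:R :> R by rewrite ler1n subn_gt0 ltn_ord.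
  have -> : 4 / (2 * (n - m)%N%:R - 1) ^+ 2 = (2 / (2 * (n - m)%N%:R - 1)) ^+ 2 :> R.
    by rewrite expr_div_n; congr (_ / _); ring.
  rewrite lerXn2r ?nnegrE //; first by rewrite divr_ge0 //; lra.
  apply: le_trans fle _; rewrite ler_pM2l ?ltr0n // lef_pV2 ?posrE; lra.
rewrite big_split /= [X in _ + X](reindex_inj oppr_inj) /=.
rewrite [X in _ + X](eq_bigr (fun m : 'I_N.+2 => g m)); last by move=> m _; rewrite /gN opprK.
rewrite [X in _ + X](eq_bigl (fun m => ~~ window T m)); last by move=> m; rewrite windowN.
suff h : \sum_(m : 'I_N.+2 | ~~ window T m) g m <= T%:R^-1 by lra.
apply: le_trans (sum_inv_sqr_le n T0).
rewrite -(big_mkord (fun m => ~~ ((m <= T)%N || (n - T <= m)%N)) g).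
rewrite big_mkcond [leRHS]big_mkcond.
have [nT|Tn] := leqP n T.+1.
  rewrite [leRHS]big_geq // big_nat_cond big1 // => i /andP[/andP[_ ilt] _].
  by rewrite ifN // negbK; apply/orP; left; lia.
rewrite [leLHS](@big_cat_nat _ _ _ T.+1) ?(ltnW Tn) //=.
rewrite big_nat_cond big1 ?add0r; last first.
  move=> i /andP[/andP[_ ilt] _]; rewrite ifN // negbK; apply/orP; left; lia.
by apply: ler_sum => i _ /=; case: ifP => // _; exact: g0.
Qed.

Lemma window_sum_le T : (2 * T < n)%N ->
  \sum_(m in [pred m | window T m]) normc (fcoef w m) <=
  1 + 4 * \sum_(i < T) (i.+1)%:R^-1.
Proof.
move=> Tn; pose g (k : nat) : R := if (0 < k <= T)%N then 2 / k%:R else 0.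
pose gN (m : 'I_N.+2) := g (- m : 'I_N.+2).
have g0 k : 0 <= g k by rewrite /g; case: ifP => // _; rewrite divr_ge0.
have sg : \sum_(m : 'I_N.+2) g m = 2 * \sum_(i < T) (i.+1)%:R^-1.
  rewrite -(big_mkord xpredT g) (@big_cat_nat _ _ _ T.+1) //=; last by rewrite -/n; lia.
  rewrite [X in _ + X]big_nat_cond [X in _ + X]big1 ?addr0; last first.
    by move=> i /andP[/andP[Ti _] _]; rewrite /g ifN // negb_and -!ltnNge Ti orbT.
  rewrite big_nat_recl //= {1}/g ltnn add0r big_mkord mulr_sumr.
  by apply: eq_bigr => i _; rewrite /g /= ltn_ord.
apply: le_trans (_ : \sum_(m : 'I_N.+2) ((m == 0)%:R + (g m + gN m)) <= _); last first.
  rewrite !big_split /= [X in _ + (_ + X)](reindex_inj oppr_inj) /=.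
  rewrite [X in _ + (_ + X)](eq_bigr (fun m : 'I_N.+2 => g m)); last by move=> m _; rewrite /gN opprK.
  have -> : \sum_(m : 'I_N.+2) (m == 0)%:R = 1 :> R.
    rewrite (bigD1 0) //= [X in _ + X]big1 => [|m /negPf -> //]; exact: addr0.
  by rewrite sg; lra.
rewrite big_mkcond; apply: ler_sum => m _; rewrite inE.
case: ifP => [mW|_]; last by rewrite !addr_ge0 // /gN.
have [m0|m0] := eqVneq m 0.
  (* The coefficient at 0 is at most 1 because the total $\ell^2$ mass is 1; this is the isolated 1
     in the bound. *)
  apply: le_trans (_ : 1 <= _); last by rewrite lerDl addr_ge0 // /gN.
  rewrite -(@ler_pXn2r _ 2) ?nnegrE ?normc_ge0 // expr1n -/(sqnorm _).
  rewrite -(sum_sqnorm_fcoef wroot_sqnorm wroot_prim) (bigD1 m) //= lerDl.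
  by apply: sumr_ge0 => *; exact: sqnorm_ge0.
rewrite add0r; have mpos : (0 < m)%N by rewrite lt0n.
have mm : 1 <= (m : nat)%:R :> R by rewrite ler1n.
case/orP: mW => mT.
  apply: le_trans (_ : g m <= _); last by rewrite lerDl /gN.
  rewrite /g mpos mT; apply: le_trans (normc_fcoef_low mpos _) _; first by lia.
  rewrite ler_pM2l ?ltr0n // lef_pV2 ?posrE; lra.
have nm0 : (0 < n - m)%N by rewrite subn_gt0 ltn_ord.
have nm : 1 <= (n - m)%N%:R :> R by rewrite ler1n.
apply: le_trans (_ : gN m <= _); last by rewrite lerDr.
have mlt := ltn_ord m.
rewrite /gN val_opp // /g nm0 /= ifT; last by rewrite leq_subLR addnC -leq_subLR.
apply: le_trans (normc_fcoef_high _) _; first by move: mT mlt; rewrite -/n; lia.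
rewrite ler_pM2l ?ltr0n // lef_pV2 ?posrE; lra.
Qed.

End RootsOfUnity.

(** Each dyadic block contributes at most 1. With [T] a power of two, the logarithmic bound on $M$
    is linear in the exponent. *)
Lemma harmonic_pow2 (K : nat) : \sum_(i < 2 ^ K) (i.+1)%:R^-1 <= K.+1%:R :> R.
Proof.
elim: K => [|K IH]; first by rewrite expn0 big_ord1 invr1.
rewrite expnS mul2n -addnn big_split_ord /=.
apply: le_trans (_ : K.+1%:R + 1 <= _); last by rewrite natr1.
apply: lerD => //; apply: le_trans (_ : \sum_(i < 2 ^ K) (2 ^ K)%N%:R^-1 <= _).
  apply: ler_sum => i _; rewrite lef_pV2 ?posrE ?ltr0n ?expn_gt0 // ler_nat.
  by rewrite -addnS leq_addr.
by rewrite sumr_const card_ord -[_ *+ _]mulr_natl divff // pnatr_eq0 -lt0n expn_gt0.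
Qed.

(** Makes $C M^6 \le T$ possible. The exponent $7j$ gives $2^{7j} \ge (j+1)^7$, one power more than
    the sixth power of $28j + 5 \le 32(j+1)$. *)
Lemma window_scale (C : R) : exists j : nat, C * (4 * (7 * j).+1%:R + 1) ^+ 6 <= (2 ^ (7 * j))%:R :> R.
Proof.
have [j hj] : exists j : nat, `|C| * 32 ^+ 6 <= j.+1%:R.
  exists (Num.bound (`|C| * 32 ^+ 6)); apply: le_trans (ltW (archi_boundP _)) _.
    by rewrite mulr_ge0 ?exprn_ge0.
  by rewrite ler_nat.
exists j; have j1 : 1 <= j.+1%:R :> R by rewrite ler1n.
apply: le_trans (_ : `|C| * (32 * j.+1%:R) ^+ 6 <= _).
  apply: le_trans (_ : `|C| * (4 * (7 * j).+1%:R + 1) ^+ 6 <= _).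
    by rewrite ler_wpM2r ?ler_norm // exprn_ge0 // addr_ge0 // mulr_ge0.
  rewrite ler_wpM2l // lerXn2r ?nnegrE ?addr_ge0 ?mulr_ge0 //.
  rewrite -(natr1 (7 * j)) natrM -(natr1 j) in j1 *; have := ler0n R j; lra.
rewrite exprMn mulrA; apply: le_trans (_ : j.+1%:R * j.+1%:R ^+ 6 <= _).
  by rewrite ler_wpM2r // exprn_ge0.
rewrite -exprS -natrX ler_nat mulnC expnM leq_exp2r //.
exact: ltn_expl.
Qed.

(** * The Jacobi symbol of the statement and its Gauss sum *)

Section JacobiLink.

Variable N : nat.
Let n := N.+2.
Hypothesis odd_n : odd n.
Hypothesis sqf_n : squarefree n.

Lemma legendre_qchar p (a : nat) : prime p ->
  IZR (legendre a p) = (qchar (a%:R : 'F_p))%:~R.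
Proof.
move=> pp; rewrite /legendre /qchar (dvdn_pcharf (pchar_Fp pp)).
case: eqP => // _; have p1 := prime_gt1 pp.
suff -> : [exists x : 'I_p, ((x * x) %% p == a %% p)%N] = [exists y : 'F_p, y ^+ 2 == a%:R].
  by case: ifP => _ //; rewrite (opp_IZR 1).
have pE : (Zp_trunc (pdiv p)).+2 = p by rewrite Fp_cast.
have sqE (k : nat) : ((k%:R : 'F_p) ^+ 2 == a%:R) = ((k * k) %% p == a %% p)%N.
  by rewrite expr2 -natrM -val_eqE /= !val_Fp_nat.
apply/existsP/existsP => -[x xE].
  by exists ((x : nat)%:R); rewrite sqE.
have xp : (x < p)%N by rewrite -[X in (_ < X)%N]pE ltn_ord.
exists (Ordinal xp) => /=; rewrite -sqE natr_Zp; exact: xE.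
Qed.

Lemma jacobi_jchar (x : 'I_N.+2) : IZR (jacobi x n) = (jchar x)%:~R.
Proof.
rewrite /jacobi /jchar prime_decompE rmorph_prod /=.
have : all (fun p => prime p && (logn p n == 1)%N) (primes n).
  apply/allP => p pP; have := pP; rewrite mem_primes => /and3P[pp _ pn].
  rewrite pp /= eqn_leq logn_gt0 pP andbT leqNgt; apply: contra (sqf_n pp) => l2.
  by rewrite mulnn pfactor_dvdn.
elim: (primes n) => [|p s IH] /=; first by rewrite big_nil.
move=> /andP[/andP[pp /eqP l1] sP]; rewrite big_cons mult_IZR IH //; congr (_ * _).
by rewrite l1 Z.pow_1_r legendre_qchar.
Qed.

Lemma card_primes_le : (2 ^ size (primes n) <= n)%N.
Proof.
rewrite [X in (_ <= X)%N](prod_prime_decomp (n := n)) // prime_decompE big_map /=.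
have : all (fun p => prime p && (0 < logn p n)%N) (primes n).
  apply/allP => p pP; rewrite logn_gt0 pP andbT.
  by move: pP; rewrite mem_primes => /and3P[].
elim: (primes n) => [|p s IH] /=; first by rewrite big_nil.
move=> /andP[/andP[pp l1] sP]; rewrite big_cons expnS leq_mul ?IH //.
apply: leq_trans (prime_gt1 pp) _; rewrite -[X in (X <= _)%N]expn1.
by rewrite leq_exp2l ?prime_gt1.
Qed.

Definition gauss : R[i] := \sum_(x : 'I_N.+2) ((jchar x)%:~R : R)%:C * psi (wroot N) x.

Lemma dft_jchar (k : 'I_N.+2) :
  \sum_(x : 'I_N.+2) ((jchar x)%:~R : R)%:C * psi (wroot N) (x * k) = ((jchar k)%:~R : R)%:C * gauss.
Proof.
have e (y : 'I_N.+2) : ((jchar y)%:~R : R)%:C = (jchar y)%:~R :> R[i] by rewrite rmorph_int.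
rewrite /gauss !e; under eq_bigr do rewrite e.
under [in RHS]eq_bigr do rewrite e.
exact: jchar_dft.
Qed.

(** Parseval applied to the character: by [dft_jchar] both sides contain its $\ell^2$ mass, which is
    nonzero since the character is 1 at 1. *)
Lemma sqnorm_gauss : sqnorm gauss = n%:R.
Proof.
have := parseval (wroot_sqnorm N) (wroot_prim N) (fun x : 'I_N.+2 => ((jchar x)%:~R : R)%:C).
rewrite /dft; under eq_bigr do rewrite dft_jchar sqnormM.
rewrite -mulr_suml mulrC; apply: mulIf.
rewrite gt_eqF // (bigD1 1) //=.
have j1 : jchar (1 : 'I_N.+2) ^+ 2 = 1.
  by rewrite jchar_sqr // jchar_eq0 // coprime1n.
rewrite sqnormR -rmorphXn /= j1 ltr_pwDl //.
by apply: sumr_ge0 => *; exact: sqnorm_ge0.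
Qed.

End JacobiLink.

(** * Rotated character polynomials *)

Lemma modn_Zmod (i j k : nat) : (i < k)%N -> (j < k)%N ->
  Z.to_nat (Z.modulo (Z.of_nat i + Z.of_nat j) (Z.of_nat k)) = ((i + j) %% k)%N.
Proof.
move=> ik jk; have [lt|ge] := ltnP (i + j) k.
  by rewrite modn_small // Z.mod_small; lia.
rewrite -(Z.mod_unique (Z.of_nat i + Z.of_nat j) (Z.of_nat k) 1
   (Z.of_nat i + Z.of_nat j - Z.of_nat k)); [|left; lia|lia].
have -> : (i + j = (i + j - k) + k)%N by rewrite subnK.
by rewrite modnDr modn_small; lia.
Qed.

Lemma IZR_natr (k : nat) : IZR (Z.of_nat k) = k%:R.
Proof. by rewrite -INR_IZR_INZ INRE. Qed.

Section Rotation.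

Variable N : nat.
Let n := N.+2.
Hypothesis odd_n : odd n.
Hypothesis sqf_n : squarefree n.
Variables (r : R) (v : nat -> Z).
Hypothesis vV : inVn n v.

Let f : Z := floorZ (Rmult (INR n) r).
Let s : 'I_N.+2 := inZp (Z.to_nat (Z.modulo f (Z.of_nat n))).
Let chi (x : 'I_N.+2) : R := (jchar x)%:~R.
Let vv (x : 'I_N.+2) : R := IZR (v (x + s)%R).
Let a := addp (rotp n r (Jpoly n)) (rotp n r (fun j => IZR (v j))).
Let z : R := \sum_x (chi x == 0)%:R.

Lemma val_shift : Z.of_nat s = Z.modulo f (Z.of_nat n).
Proof.
have h := Z.mod_pos_bound f (Z.of_nat n) ltac:(done).
rewrite /s /= -/n; move: (Z.modulo f (Z.of_nat n)) h => g [g0 g1].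
rewrite modn_small; first by rewrite Z2Nat.id.
by move: g0 g1; rewrite /n; clear; lia.
Qed.

Let t : 'I_N.+2 := - (s + s).
Let y : R := (2 * (t : nat)%:R + 2 - n%:R) / n%:R.

Lemma t_floor : exists k : Z, Z.of_nat t = Z.add (Z.mul (-2) f) (Z.mul (Z.of_nat n) k).
Proof.
have vD (x1 x2 : 'I_N.+2) : ((x1 + x2)%R : nat) = ((x1 + x2) %% n)%N by [].
have h : ((t + (s + s))%R : nat) = 0%N by rewrite /t addNr.
move: h; rewrite !vD modnDmr => /eqP; rewrite -/(dvdn n _) => /dvdnP[q tq].
have := Z.div_mod f (Z.of_nat n) ltac:(done); rewrite -val_shift.
move: (Z.div f (Z.of_nat n)) => g fg; exists (Z.add (Z.of_nat q) (Z.mul 2 g)).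
have {}tq : Z.add (Z.of_nat t) (Z.add (Z.of_nat s) (Z.of_nat s)) =
    Z.mul (Z.of_nat q) (Z.of_nat n).
  by rewrite -!Nat2Z.inj_add -Nat2Z.inj_mul; congr Z.of_nat.
rewrite fg; move: tq; clear; move: (Z.of_nat t) (Z.of_nat s) (Z.of_nat q) (Z.of_nat n) => *; lia.
Qed.

Lemma y_sqr_lower :
  16 * (`|r + IZR (floorZ (Rminus (Rinv 2) r))| - 4^-1) ^+ 2 - 12 / n%:R <= y ^+ 2.
Proof.
have [k tk] := t_floor.
(* The integer by which [fper] brings [r] into $(-1/2, 1/2]$. *)
pose m := floorZ (Rminus (Rinv 2) r).
have [f1 f2] := base_Int_part (Rmult (INR n) r).
have [m1 m2] := base_Int_part (Rminus (Rinv 2) r).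
have f1' : Rle (IZR f) (Rmult (INR n) r) := f1.
have f2' : Rlt (-1) (Rminus (IZR f) (Rmult (INR n) r)) := f2.
have m1' : Rle (IZR m) (Rminus (Rinv 2) r) := m1.
have m2' : Rlt (-1) (Rminus (IZR m) (Rminus (Rinv 2) r)) := m2.
have im1 : IZR (-1) = - 1 := opp_IZR 1.
rewrite im1 in f2' m2'.
have n2 : 2 <= n%:R :> R by rewrite ler_nat.
have i2 : IZR 2 = 2 by exact: (IZR_natr 2).
have i4 : IZR 4 = 4 by exact: (IZR_natr 4).
have i12 : IZR 12 = 12 by exact: (IZR_natr 12).
have i16 : IZR 16 = 16 by exact: (IZR_natr 16).
have im2 : IZR (-2) = - 2 by rewrite (opp_IZR 2) i2.
have := @triangle_wave (INR n) r (Rplus r (IZR m)) (INR t) f k m.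
rewrite INRE [INR t]INRE i2 i4 i12 i16 im2 !RealsE => H; apply/RleP; apply: H.
- by apply/RleP.
- by move: f1'; rewrite INRE.
- by move: f2'; rewrite INRE => f2'; apply/RltP; move/RltP: f2'; rewrite !RealsE; lra.
- by apply/RleP.
- by apply/RleP; rewrite natr1 ler_nat ltn_ord.
- have := congr1 IZR tk; rewrite plus_IZR !mult_IZR im2 IZR_natr [IZR (Z.of_nat n)]IZR_natr => ->.
  by rewrite !RealsE mulNr.
- by [].
- by move: m2'; rewrite i2 => /RltP h; apply/RleP; move: h; rewrite !RealsE; lra.
- by move: m1'; rewrite i2 => /RleP h; apply/RleP; move: h; rewrite !RealsE; lra.
Qed.

Lemma rot_index (x : 'I_N.+2) :
  Z.to_nat (Z.modulo (Z.of_nat x + f) (Z.of_nat n)) = (x + s)%R :> nat.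
Proof.
by rewrite -Zplus_mod_idemp_r -val_shift modn_Zmod.
Qed.

Lemma coefE (x : 'I_N.+2) : a x = chi (x + s) + vv x.
Proof.
rewrite /a /addp /rotp -/f rot_index RplusE; congr (_ + _).
(* At index 0 [Jpoly] is 0 by its guard, and [jchar] vanishes there too because [n > 1]. *)
rewrite /Jpoly ltn_ord andbT; case: ltnP => h; first by rewrite jacobi_jchar.
have -> : x + s = 0 by apply/val_inj => /=; apply/eqP; rewrite -leqn0.
have /eqP : jchar (0 : 'I_N.+2) == 0.
  by rewrite jchar_eq0 //= /coprime gcd0n.
by rewrite /chi => ->.
Qed.

Lemma vv_sqr (x : 'I_N.+2) : vv x ^+ 2 = (chi (x + s) == 0)%:R.
Proof.
have [h1 h2] := vV (ltn_ord (x + s)).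
rewrite /chi intr_eq0 jchar_eq0 //.
have [c|c] /= := boolP (coprime (x + s)%R n).
  by rewrite /vv (h2.2 c) expr0n.
have : v (x + s)%R <> Z0 by move/h2; rewrite (negbTE c).
rewrite /vv; case: h1 => [-> //|[->|->] _]; first by rewrite expr1n.
by rewrite (opp_IZR 1) sqrrN expr1n.
Qed.

Lemma chi_sqrE (x : 'I_N.+2) : chi x ^+ 2 = (chi x != 0)%:R.
Proof.
rewrite /chi -rmorphXn /= jchar_sqr // intr_eq0.
by case: (_ != _).
Qed.

Lemma sum_coef_sqr : rsum n (fun j => pow (a j) 2) = INR n.
Proof.
rewrite rsumE INRE -[X in _ = X%:R](card_ord n) -sumr_const; apply: eq_bigr => x _.
rewrite RpowE coefE.
have h1 := vv_sqr x; have h2 := chi_sqrE (x + s).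
have [c0|c0] := eqVneq (chi (x + s)) 0.
  by rewrite c0 add0r h1 c0 eqxx.
rewrite (negbTE c0) in h1; rewrite c0 in h2.
by move/eqP: h1; rewrite sqrf_eq0 => /eqP ->; rewrite addr0 h2.
Qed.

Variables (T : nat) (e : R).
Hypothesis T_gt0 : (0 < T)%N.
Hypothesis Tn : (2 * T < n)%N.
Hypothesis Tp : ((2 * T).+1 <= pdiv n)%N.
Hypothesis e_gt0 : 0 < e.
Hypothesis ep : 1000 <= (pdiv n)%:R * e ^+ 4.
Hypothesis ez : 4 * z <= e * n%:R.

Lemma zE : z = #|[pred x : 'I_N.+2 | jchar x == 0]|%:R.
Proof.
rewrite -sum1_card natr_sum [RHS]big_mkcond /z; apply: eq_bigr => x _.
by rewrite inE /chi intr_eq0; case: (_ == _).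
Qed.

(** Translating the window by [T] gives natural shifts below [2 * T + 1], the form that
    [sum_jchar4_unpaired] expects; complete sums are unaffected. *)
Lemma window_index (x : 'I_N.+2) : window T x ->
  exists2 i : nat, (i < (2 * T).+1)%N & x = i%:R - T%:R.
Proof.
move=> xW; exists (x + T%:R : 'I_N.+2)%R; last by rewrite natr_Zp addrK.
have -> : T%:R = inZp T :> 'I_N.+2 by exact: Zp_nat.
rewrite /= (@modn_small T); last by move: Tn; rewrite /n; lia.
case/orP: xW => h.
  by rewrite modn_small; move: Tn h; rewrite /n; move: (x : nat) => k; lia.
have xn := ltn_ord x.
have -> : (x + T = (x + T - n) + n)%N.
  by rewrite subnK //; move: Tn h; rewrite /n; move: (x : nat) => k; lia.
rewrite modnDr modn_small; move: Tn h xn; rewrite /n; move: (x : nat) => k; lia.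
Qed.

(** [ez] handles the paired shifts and [ep] the unpaired ones, where the fourth power of the sum is
    at most $1000 n^4/p$. *)
Lemma window_sum4 (x x2 x3 x4 : 'I_N.+2) : window T x -> window T x2 -> window T x3 -> window T x4 ->
  `|\sum_l chi (l + x) * chi (l + x2) * chi (l + x3) * chi (l + x4) -
       n%:R * (paired x x2 x3 x4)%:R| <= e * n%:R.
Proof.
move=> xW yW uW tW.
have n0 : 0 < n%:R :> R by rewrite ltr0n.
have -> : \sum_l chi (l + x) * chi (l + x2) * chi (l + x3) * chi (l + x4) =
  (\sum_l jchar (l + x) * jchar (l + x2) * jchar (l + x3) * jchar (l + x4))%:~R.
  by rewrite rmorph_sum; apply: eq_bigr => l _; rewrite !rmorphM.
have [pr|npr] := boolP (paired x x2 x3 x4).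
  rewrite mulr1 -[X in _ - X](rmorph_nat (intmul 1)) -rmorphB /= -intr_norm.
  have := sum_jchar4_paired odd_n pr; rewrite -(ler_int R) => h.
  apply: le_trans h _; rewrite rmorphM !rmorph_nat -zE; exact: ez.
rewrite mulr0 subr0.
have [i iL xi] := window_index xW; have [j jL yj] := window_index yW.
have [k kL uk] := window_index uW; have [m mL tm] := window_index tW.
have npr' : ~~ paired i j k m.
  apply: contra npr; rewrite /paired xi yj uk tm => /or3P[] /andP[/eqP-> /eqP->];
  by rewrite !eqxx ?orbT.
have := sum_jchar4_unpaired odd_n (sqf_n : forall p, prime p -> _) Tp iL jL kL mL npr'.
have -> : \sum_(l : 'I_N.+2) jchar (l + i%:R) * jchar (l + j%:R) * jchar (l + k%:R) * jchar (l + m%:R) =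
  \sum_l jchar (l + x) * jchar (l + x2) * jchar (l + x3) * jchar (l + x4).
  apply/esym; rewrite (reindex_inj (addIr (T%:R : 'I_N.+2))) /=; apply: eq_bigr => l _.
  by rewrite xi yj uk tm !addrA ![l + T%:R + _]addrAC !addrK.
move: (\sum_l _) => S; rewrite -(ler_int R) rmorphM rmorphXn [X in _ <= X]rmorphM rmorphXn !rmorph_nat => h.
rewrite -(@ler_pXn2r _ 4) ?nnegrE ?normr_ge0 ?(mulr_ge0 (ltW e_gt0) (ltW n0)) //.
rewrite -normrX ger0_norm ?exprn_even_ge0 //.
have p0 : 0 < (pdiv n)%:R :> R by rewrite ltr0n pdiv_gt0.
rewrite -(ler_pM2r p0); apply: le_trans h _.
rewrite exprMn mulrAC ler_wpM2r ?exprn_ge0 // mulrC; exact: ep.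
Qed.

(** Sum of [even_part] and [odd_part], so $7/3 = 1 + 4/3$, with the tail and the $\ell^1$ norm
    replaced by bounds depending on [T] alone. *)
Lemma L4_lower (M0 eta eta' : R) : 0 < eta -> 0 < eta' ->
  1 + 4 * \sum_(i < T) (i.+1)%:R^-1 <= M0 ->
  n%:R ^+ 3 * (7 / 3 + y ^+ 2 - (z / n%:R + 2 * eta' + 2 * (z / n%:R) / eta' + 12 / T%:R
     + 4 / (3 * n%:R ^+ 2) + e * M0 ^+ 4
     + 2 * M0 ^+ 3 * (eta + 2 * (2 / T%:R + z / n%:R) / eta))) <=
  rsum (2 * n) (fun k => pow (poly_sq n a (Rdiv (Rmult PI (INR k)) (INR n))) 2).
Proof.
move=> e0 e0' HM; have n0 : 0 < n%:R :> R by rewrite ltr0n.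
have dfte (g h : 'I_N.+2 -> R[i]) l : (forall x, g x = h x) ->
    dft (wroot N) g l = dft (wroot N) h l.
  by move=> gh; apply: eq_bigr => x _; rewrite gh.
have -> : rsum (2 * n) (fun k => pow (poly_sq n a (Rdiv (Rmult PI (INR k)) (INR n))) 2) =
    \sum_l sqnorm (dft (wroot N) (fun x => (chi (x + s) + vv x)%:C) l) ^+ 2 +
    \sum_l sqnorm (dft (wroot N) (fun x => (chi (x + s) + vv x)%:C * halfu (wroot N) x) l) ^+ 2.
  rewrite rsum_double; congr (_ + _); apply: eq_bigr => l _; rewrite RpowE.
    rewrite poly_sq_even; congr (sqnorm _ ^+ 2).
    by apply: dfte => x; rewrite coefE.
  rewrite poly_sq_odd; congr (sqnorm _ ^+ 2).
  by apply: dfte => x; rewrite coefE.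
have sG := sqnorm_gauss odd_n sqf_n.
have hd := dft_jchar odd_n sqf_n.
have ev := even_part (wroot_sqnorm N) (wroot_prim N) chi_sqrE hd sG vv_sqr e0'.
pose W : {pred 'I_N.+2} := [pred m | window T m].
have HW x1 x2 x3 x4 : x1 \in W -> x2 \in W -> x3 \in W -> x4 \in W ->
    `|\sum_l chi (l + x1) * chi (l + x2) * chi (l + x3) * chi (l + x4) -
       n%:R * (paired x1 x2 x3 x4)%:R| <= e * n%:R.
  by rewrite !inE; exact: window_sum4.
have od := odd_part (wroot_sqnorm N) (wroot_n N) (wroot_prim N) chi_sqrE hd sG vv_sqr HW e0.
apply: le_trans (lerD ev od).
have tl := tail_le N T_gt0; have wl := le_trans (window_sum_le Tn) HM.
have M0' : 0 <= \sum_(m in W) normc (fcoef (wroot N) m).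
  by apply: sumr_ge0 => m _; exact: normc_ge0.
have tl0 : 0 <= \sum_(m | m \notin W) sqnorm (fcoef (wroot N) m).
  by apply: sumr_ge0 => m _; exact: sqnorm_ge0.
have -> : (`|2 * ((- (s + s) : 'I_N.+2) : nat)%:R + 2 - N.+2%:R| / N.+2%:R) ^+ 2 = y ^+ 2 :> R.
  by rewrite /y !expr_div_n -normrX ger0_norm ?sqr_ge0.
rewrite -/z -/n in ev od *.
have z0 : 0 <= z by apply: sumr_ge0 => x _; rewrite ler0n.
move: (\sum_(m in W) _) (\sum_(m | m \notin W) _) wl tl M0' tl0 => M tau wl tl M0' tl0.
have -> : 12 / T%:R = 6 * (2 / T%:R) :> R by rewrite mulrA -natrM.
rewrite -/n in wl tl *; move: (y ^+ 2) => yy; move: (z) z0 => zz zz0.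
move: (n%:R : R) n0 => nn nn0; move: (2 / T%:R : R) tl => tt tl.
have -> : nn ^+ 2 * (nn - zz) - 2 * nn ^+ 3 * eta' - 2 * nn ^+ 2 * zz / eta' +
  (nn ^+ 2 * (nn * (4 / 3 + yy - 6 * tau - 4 / (3 * nn ^+ 2)) - e * nn * M ^+ 4) -
   2 * M ^+ 3 * (nn ^+ 3 * eta + 2 * nn ^+ 2 * (nn * tau + zz) / eta)) =
  nn ^+ 3 * (7 / 3 + yy - (zz / nn + 2 * eta' + 2 * (zz / nn) / eta' + 6 * tau
     + 4 / (3 * nn ^+ 2) + e * M ^+ 4
     + 2 * M ^+ 3 * (eta + 2 * (tau + zz / nn) / eta))).
  by field; rewrite !gt_eqF.
have zn0 : 0 <= zz / nn by rewrite divr_ge0 // ltW.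
apply: ler_wpM2l; first by rewrite exprn_ge0 // ltW.
apply: lerB => //; apply: lerD.
  apply: lerD; first by apply: lerD => //; apply: lerD => //; rewrite ler_wpM2l.
  by rewrite ler_wpM2l ?(ltW e_gt0) // lerXn2r ?nnegrE // (le_trans M0').
apply: ler_pM.
- by rewrite mulr_ge0 // exprn_ge0.
- by rewrite addr_ge0 ?(ltW e0) // divr_ge0 ?(ltW e0) // mulr_ge0 // addr_ge0.
- by rewrite ler_wpM2l // lerXn2r ?nnegrE // (le_trans M0').
- by rewrite lerD2l ler_wpM2r ?invr_ge0 ?(ltW e0) // ler_wpM2l // lerD2r.
Qed.

Lemma L4_lower_wave (M0 eta eta' : R) : 0 < eta -> 0 < eta' ->
  1 + 4 * \sum_(i < T) (i.+1)%:R^-1 <= M0 ->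
  n%:R ^+ 3 * (7 / 3
     + (16 * (`|r + IZR (floorZ (Rminus (Rinv 2) r))| - 4^-1) ^+ 2 - 12 / n%:R)
     - (z / n%:R + 2 * eta' + 2 * (z / n%:R) / eta' + 12 / T%:R
     + 4 / (3 * n%:R ^+ 2) + e * M0 ^+ 4
     + 2 * M0 ^+ 3 * (eta + 2 * (2 / T%:R + z / n%:R) / eta))) <=
  rsum (2 * n) (fun k => pow (poly_sq n a (Rdiv (Rmult PI (INR k)) (INR n))) 2).
Proof.
move=> e0 e0' HM; apply: le_trans (L4_lower e0 e0' HM).
by rewrite ler_wpM2l ?exprn_ge0 // lerD2r lerD2l; exact: y_sqr_lower.
Qed.

End Rotation.

(** * From the fourth moment to the merit factor: choice of parameters *)

Lemma merit_arith (nn S g d eps : R) : 0 < nn -> 6^-1 <= g -> d <= 12^-1 -> 72 * d <= eps ->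
  0 <= d -> nn ^+ 3 * (2 * (1 + g - d)) <= S ->
  nn ^+ 2 / ((2 * nn)^-1 * S - nn ^+ 2) <= g^-1 + eps.
Proof.
move=> n0 g6 d12 de d0 h.
pose X := S / (2 * nn ^+ 3).
have X1 : g - d <= X - 1.
  have : 1 + g - d <= X.
    rewrite /X ler_pdivlMr; last by rewrite mulr_gt0 // exprn_gt0.
    by apply: le_trans h; rewrite le_eqVlt; apply/orP; left; apply/eqP; ring.
  lra.
have gd : 12^-1 <= g - d by lra.
have g0 : 0 < g by lra.
have gd0 : 0 < g - d by lra.
have X0 : 0 < X - 1 by lra.
have -> : nn ^+ 2 / ((2 * nn)^-1 * S - nn ^+ 2) = (X - 1)^-1.
  have -> : (2 * nn)^-1 * S - nn ^+ 2 = nn ^+ 2 * (X - 1) by rewrite /X; field; rewrite gt_eqF.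
  by rewrite invfM mulrA divff ?mul1r // expf_neq0 // gt_eqF.
apply: le_trans (_ : (g - d)^-1 <= _); first by rewrite lef_pV2 ?posrE.
have -> : (g - d)^-1 = g^-1 + d / (g * (g - d)) by field; rewrite !gt_eqF.
rewrite lerD2l ler_pdivrMr ?mulr_gt0 //.
(* From $g \ge 1/6$ and $g - d \ge 1/12$; hence the factor 72 in the hypothesis. *)
have : 72^-1 <= g * (g - d) by nra.
nra.
Qed.

(** Every error term of [L4_lower_wave] becomes a small multiple of [d1]. The generous allowance
    [20 * d1] in [merit_arith] explains $240 = 12 \cdot 20$ and $1440 = 72 \cdot 20$; [zeta] bounds
    the density of zeros of the character. *)
Lemma merit_le (N : nat) (r : R) (v : nat -> Z) (j : nat) (d1 M0 e zeta eps : R) :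
  let n := N.+2 in let T := (2 ^ (7 * j))%N in
  odd n -> squarefree n -> inVn n v ->
  0 < d1 -> d1 <= 240^-1 -> 1440 * d1 <= eps ->
  M0 = 4 * (7 * j).+1%:R + 1 -> 12 / d1 ^+ 2 * M0 ^+ 6 <= T%:R ->
  e = d1 / M0 ^+ 4 ->
  zeta <= d1 ^+ 2 -> 4 * M0 ^+ 6 * zeta <= d1 ^+ 2 -> 4 * zeta <= e ->
  (size (primes n))%:R <= zeta * (pdiv n)%:R ->
  (2 * T).+1%:R <= (pdiv n)%:R :> R -> 1000 <= (pdiv n)%:R * e ^+ 4 ->
  6 <= d1 * (pdiv n)%:R ->
  merit n (addp (rotp n r (Jpoly n)) (rotp n r (fun j => IZR (v j)))) <= fper r + eps.
Proof.
move=> n T odd_n sqf_n vV d0 d240 deps ME TE eE z1 z2 z3 sz Tp ep d6.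
have p0 : (0 < pdiv n)%N by rewrite pdiv_gt0.
have pn : (pdiv n <= n)%N by apply: dvdn_leq (pdiv_dvd n).
have n0 : 0 < n%:R :> R by rewrite ltr0n.
have T0 : (0 < T)%N by rewrite expn_gt0.
rewrite ler_nat in Tp; have Tn : (2 * T < n)%N by apply: leq_trans pn.
have M1 : 1 <= M0 by rewrite ME lerDr mulr_ge0.
have M00 : 0 < M0 by lra.
have e0 : 0 < e by rewrite eE divr_gt0 // exprn_gt0.
pose z : R := \sum_(x : 'I_N.+2) ((jchar x)%:~R == 0 :> R)%:R.
have z0 : 0 <= z by apply: sumr_ge0 => x _; rewrite ler0n.
have zz : z / n%:R <= zeta.
  have := card_jchar_eq0 sqf_n; rewrite -(ler_nat R) !natrM -zE -/z => h.
  have p0' : 0 < (pdiv n)%:R :> R by rewrite ltr0n.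
  rewrite ler_pdivrMr // -(ler_pM2r p0'); apply: le_trans h _.
  by rewrite mulrAC ler_pM2r.
have zn0 : 0 <= z / n%:R by rewrite divr_ge0 // ltW.
have ez : 4 * z <= e * n%:R.
  have -> : z = z / n%:R * n%:R by rewrite divfK // gt_eqF.
  by rewrite mulrA ler_pM2r //; lra.
have M3 : 0 < M0 ^+ 3 by rewrite exprn_gt0.
have HM : 1 + 4 * \sum_(i < T) (i.+1)%:R^-1 <= M0.
  by have := harmonic_pow2 (7 * j); rewrite ME -/T; lra.
(* At the odd points [eta] is [d1 / M0 ^+ 3], to cancel the factor [M0 ^+ 3]; at the even points
   [eta'] is [d1]. *)
have := L4_lower_wave odd_n sqf_n r vV T0 Tn Tp e0 ep ez (divr_gt0 d0 M3) d0 HM.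
rewrite -/z => hS.
rewrite meritE; [|by apply/ssrnat.ltP|exact: sum_coef_sqr].
move: hS; set S := rsum _ _ => hS.
set rho := r + IZR _ in hS.
pose g := 6^-1 + 8 * (`|rho| - 4^-1) ^+ 2.
have -> : fper r = g^-1.
  rewrite /fper /g RinvE; congr (_^-1).
  rewrite !RealsE -/rho; congr (_^-1 + _ * (_ - _^-1) ^+ 2); by rewrite // -?INRE ?INR_IZR_INZ.
rewrite !RealsE.
apply: (@merit_arith n%:R S g (20 * d1)%R eps) => //.
- by rewrite /g lerDl mulr_ge0 // sqr_ge0.
- lra.
- lra.
- by rewrite mulr_ge0 // ltW.
apply: le_trans hS; rewrite ler_wpM2l ?exprn_ge0 ?ler0n //.
have t1 : 12 / T%:R <= d1 ^+ 2 / M0 ^+ 6.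
  rewrite ler_pdivrMr ?ltr0n // mulrAC ler_pdivlMr ?exprn_gt0 //.
  move: TE; rewrite -(ler_pM2l (exprn_gt0 2 d0)) => TE; apply: le_trans TE.
  have -> : d1 ^+ 2 * (12 / d1 ^+ 2 * M0 ^+ 6) = 12 * M0 ^+ 6 by field; rewrite gt_eqF.
  exact: lexx.
have M6 : 1 <= M0 ^+ 6 by rewrite exprn_ege1.
have t2 : 12 / T%:R <= d1 ^+ 2.
  apply: le_trans t1 _; rewrite ler_pdivrMr ?exprn_gt0 // ler_peMr //; exact: sqr_ge0.
have dd : d1 ^+ 2 <= d1 by nra.
have s1 : 2 * (z / n%:R) / d1 <= 2 * d1.
  rewrite ler_pdivrMr // -mulrA ler_wpM2l // -expr2; exact: le_trans zz z1.
have s2 : e * M0 ^+ 4 = d1 by rewrite eE divfK // expf_neq0 // gt_eqF.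
have n6 : 6 / n%:R <= d1.
  rewrite ler_pdivrMr //; apply: le_trans d6 _; rewrite ler_pM2l // ler_nat; exact: pn.
have n4 : 4 / (3 * n%:R ^+ 2) <= d1.
  apply: le_trans n6; rewrite ler_pdivlMr // mulrAC ler_pdivrMr ?mulr_gt0 ?exprn_gt0 //.
  have : 1 <= n%:R :> R by rewrite ler1n.
  by move: (n%:R : R) n0 => x x0 x1; nra.
have s3 : 2 * M0 ^+ 3 * (d1 / M0 ^+ 3 + 2 * (2 / T%:R + z / n%:R) / (d1 / M0 ^+ 3)) =
   2 * d1 + (M0 ^+ 6 * (8 / T%:R) + 4 * M0 ^+ 6 * (z / n%:R)) / d1.
  have tn0 : T%:R != 0 :> R by rewrite pnatr_eq0 -lt0n.
  have dn0 : d1 != 0 by rewrite gt_eqF.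
  have mn0 : M0 != 0 by rewrite gt_eqF.
  by move: (z / n%:R) (T%:R : R) tn0 => q t tn0; field; rewrite tn0 dn0 mn0.
have s4 : M0 ^+ 6 * (8 / T%:R) <= d1 ^+ 2.
  move: t1; rewrite ler_pdivlMr ?exprn_gt0 // => t1; apply: le_trans t1.
  by rewrite mulrC ler_pM2r ?exprn_gt0 // ler_pM2r ?invr_gt0 ?ltr0n // ler_nat.
have s5 : 4 * M0 ^+ 6 * (z / n%:R) <= d1 ^+ 2.
  apply: le_trans z2; rewrite ler_pM2l ?mulr_gt0 ?exprn_gt0 //.
have s6 : (M0 ^+ 6 * (8 / T%:R) + 4 * M0 ^+ 6 * (z / n%:R)) / d1 <= 2 * d1.
  rewrite ler_pdivrMr //; have -> : 2 * d1 * d1 = d1 ^+ 2 + d1 ^+ 2 by ring.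
  exact: lerD.
rewrite s2 s3 /g.
have e12 : 12 / n%:R = 2 * (6 / n%:R) :> R by rewrite mulrA -natrM.
rewrite e12.
have z4 := le_trans zz z1.
move: (6 / n%:R) n6 => q1 n6; move: (4 / (3 * _)) n4 => q2 n4; move: (12 / T%:R) t2 => q3 t2.
move: (2 * (z / n%:R) / d1) s1 => q5 s1; move: (_ / d1) s6 => q4 s6; move: (z / n%:R) z4 => q6 z4.
move: ((`|rho| - 4^-1) ^+ 2) => q7; lra.
Qed.

(** Order of choice: [d1] from [eps], then [j] and with it [T] and [M0], then [e] and [zeta], and
    last [eps1]. Nothing depends on [N], [r] or [v], whence the uniformity in [v]. *)
Lemma merit_parameters (eps : R) : 0 < eps ->
  exists eps1 : R, 0 < eps1 /\
  forall (N : nat) (r : R) (v : nat -> Z), let n := N.+2 in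
    odd n -> squarefree n -> inVn n v ->
    (size (primes n))%:R <= 2 * eps1 * (pdiv n)%:R -> (pdiv n)%:R^-1 < eps1 ->
    merit n (addp (rotp n r (Jpoly n)) (rotp n r (fun j => IZR (v j)))) <= fper r + eps.
Proof.
move=> eps0; pose d1 : R := Num.min (240^-1)%R (eps / 1440)%R.
have d0 : 0 < d1 by rewrite lt_min invr_gt0 ltr0n divr_gt0.
have d240 : d1 <= 240^-1 by rewrite ge_min lexx.
have deps : 1440 * d1 <= eps.
  by rewrite mulrC -ler_pdivlMr ?ltr0n // ge_min lexx orbT.
have [j hj] := window_scale (12 / d1 ^+ 2)%R.
pose M0 : R := (4 * (7 * j).+1%:R + 1)%R.
have M00 : 0 < M0 by rewrite ltr_wpDl // mulr_ge0.
pose e := d1 / M0 ^+ 4; have e0 : 0 < e by rewrite divr_gt0 // exprn_gt0.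
pose zeta : R := Num.min (d1 ^+ 2)%R (Num.min (d1 ^+ 2 / (4 * M0 ^+ 6)) (e / 4))%R.
have z0 : 0 < zeta by rewrite !lt_min !divr_gt0 ?mulr_gt0 ?exprn_gt0.
have z1 : zeta <= d1 ^+ 2 by rewrite ge_min lexx.
have z2 : 4 * M0 ^+ 6 * zeta <= d1 ^+ 2.
  rewrite mulrC -ler_pdivlMr ?mulr_gt0 ?exprn_gt0 //.
  by rewrite !ge_min lexx !orbT.
have z3 : 4 * zeta <= e by rewrite mulrC -ler_pdivlMr // !ge_min lexx !orbT.
(* Thresholds for the least prime: distinct shifts in the window, small unpaired sums, and
   negligible terms of order $1/n$. *)
pose P1 : R := ((2 * 2 ^ (7 * j)).+1%:R)%R; pose P2 := 1000 / e ^+ 4; pose P3 := 6 / d1.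
have p1 : 0 < P1 by rewrite ltr0n.
have p2 : 0 < P2 by rewrite divr_gt0 // exprn_gt0.
have p3 : 0 < P3 by rewrite divr_gt0.
pose P0 := P1 + P2 + P3; have P00 : 0 < P0 by rewrite !addr_gt0.
pose eps1 : R := Num.min (zeta / 2)%R (P0^-1)%R.
exists eps1; split; first by rewrite lt_min divr_gt0 // invr_gt0.
move=> N r v n odd_n sqf_n vV hs hp.
have q0 : 0 < (pdiv n)%:R :> R by rewrite ltr0n pdiv_gt0.
have hP : P0 <= (pdiv n)%:R.
  rewrite -lef_pV2 ?posrE //; apply: le_trans (ltW hp) _.
  by rewrite ge_min lexx orbT.
have [h1 h2 h3] : [/\ P1 <= (pdiv n)%:R, P2 <= (pdiv n)%:R & P3 <= (pdiv n)%:R].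
  clearbody P1 P2 P3; rewrite /P0 in hP; clear -hP p1 p2 p3.
  by move: (pdiv n)%:R hP => q hP; split; lra.
have H1 : (size (primes n))%:R <= zeta * (pdiv n)%:R.
  apply: le_trans hs _; rewrite ler_pM2r // mulrC -ler_pdivlMr //.
  by rewrite ge_min lexx.
have H2 : 1000 <= (pdiv n)%:R * e ^+ 4 by move: h2; rewrite /P2 ler_pdivrMr // exprn_gt0.
have H3 : 6 <= d1 * (pdiv n)%:R by move: h3; rewrite /P3 ler_pdivrMr // mulrC.
exact: (@merit_le N r v j d1 M0 e zeta eps odd_n sqf_n vV d0 d240 deps erefl hj erefl
  z1 z2 z3 H1 h1 H2 H3).
Qed.


Local Open Scope R_scope.

Theorem theorem4 (S : nat -> Prop)
  (HSinf : forall N : nat, exists n : nat, (N <= n)%N /\ S n)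
  (HSodd : forall n : nat, S n -> odd n)
  (HSsqf : forall n : nat, S n -> squarefree n)
  (HSgt1 : forall n : nat, S n -> (1 < n)%N)
  (Hlim : forall eps : R, 0 < eps -> exists N : nat, forall n : nat,
      S n -> (N <= n)%N -> ln (INR n) ^ 7 / INR (pdiv n) < eps)
  (r : R) :
  forall eps : R, 0 < eps -> exists N : nat, forall n : nat,
    S n -> (N <= n)%N ->
    forall v : nat -> Z, inVn n v ->
      merit n (addp (rotp n r (Jpoly n)) (rotp n r (fun j => IZR (v j))))
        <= fper r + eps.
Proof.
move=> eps /RltP eps0.
have [eps1 [/RltP eps10 main]] := merit_parameters eps0.
have [N0 HN0] := Hlim _ eps10.
(* The 3 ensures $\ln n \ge 1$ in [log_over_prime]. *)
exists (maxn N0 3) => n Sn; rewrite geq_max => /andP[nN0 n3] v vV.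
have h := HN0 _ Sn nN0.
have odd_n := HSodd _ Sn; have sqf_n := HSsqf _ Sn.
case: n => [|[|N]] // in Sn nN0 n3 vV h odd_n sqf_n *.
have [/RleP h1 /RltP h2] := log_over_prime n3 (pdiv_gt0 _) (card_primes_le N) h.
apply/RleP; apply: main => //; last by move: h2; rewrite !RealsE.
move: h1; rewrite (IZR_natr 2 : IZR 2 = _) !RealsE.
by rewrite ler_pdivrMr // ltr0n pdiv_gt0.
Qed.
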